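(* For the supermanifold $\mathbb{P}^{1|2}$ one has $$h^0(\mathcal{T}_{\mathbb{P}^{1|2}})=8|8,\qquad h^1(\mathcal{T}_{\mathbb{P}^{1|2}})=0.$$
   Context: $\mathbb{P}^{1|2}$ is the complex projective superspace of dimension $1|2$, covered by two affine charts with coordinates $(z|\theta_1,\theta_2)$ and $(w|\phi_1,\phi_2)$ related by $z=1/w$, $\theta_i=\phi_i/w$. $\mathcal{T}_{\mathbb{P}^{1|2}}$ is its tangent sheaf (sheaf of superderivations of the structure sheaf). $h^i=a|b$ means that $H^i$ has even dimension $a$ and odd dimension $b$. *)

(* Defs.v *)
From HB Require Import structures.
From mathcomp Require Import all_boot all_order all_algebra.
From mathcomp Require Import all_classical all_reals topology.
From mathcomp Require Import ring.
From mathcomp Require Export complex.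
Set Implicit Arguments.
Unset Strict Implicit.
Unset Printing Implicit Defensive.
Import GRing.Theory.
Local Open Scope classical_set_scope.
Local Open Scope ring_scope.

(** * Sheaf cohomology in degrees 0 and 1 *)

(* A presheaf of F-vector spaces all of whose spaces of sections are subspaces
   of one ambient space. [res V] stands for the restriction to V of sections
   over any open set containing V. *)
Record presheaf (F : fieldType) (X : topologicalType) := Presheaf {
  ambient : lmodType F;
  sec : set X -> set ambient;
  res : set X -> ambient -> ambient;
  sec_linear : forall U, open U -> sec U 0 /\
    forall (a : F) s t, sec U s -> sec U t -> sec U (a *: s + t);
  res_linear : forall V (a : F) s t,
    res V (a *: s + t) = a *: res V s + res V t;
  res_sec : forall U V s, open U -> open V -> V `<=` U ->
    sec U s -> sec V (res V s);
  res_id : forall U s, open U -> sec U s -> res U s = s;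
  res_res : forall V W s, W `<=` V -> res W (res V s) = res W s
}.

Section Cohomology.
Variables (F : fieldType) (X : topologicalType) (P : presheaf F X).
Local Notation E := (ambient P).

Definition H0_dim (n : nat) := exists b : 'I_n -> E,
  [/\ forall i, sec (setT : set X) (b i),
      forall a : 'I_n -> F, \sum_(i < n) a i *: b i = 0 -> forall i, a i = 0 &
      forall s, sec (setT : set X) s ->
        exists a : 'I_n -> F, s = \sum_(i < n) a i *: b i].

(* H^1 is Cech cohomology, i.e. the colimit of Z^1(U)/B^1(U) over all open
   covers U. As usual (Godement, II.5.8) the colimit is taken over covers
   (U_x) indexed by the points of X with x in U_x, which are cofinal among all
   open covers; V then refines U when V_x is contained in U_x for every x.
   In degree 1 this agrees with derived-functor cohomology for sheaves on an
   arbitrary topological space. *)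
Definition pointed_cover (U : X -> set X) := forall x, open (U x) /\ U x x.

Definition refines (V U : X -> set X) := forall x, V x `<=` U x.

Definition cocycle1 (U : X -> set X) (f : X -> X -> E) :=
  (forall x y, sec (U x `&` U y) (f x y)) /\
  (forall x y z, let W := U x `&` U y `&` U z in
     res W (f y z) - res W (f x z) + res W (f x y) = 0).

Definition coboundary1 (U : X -> set X) (f : X -> X -> E) :=
  exists2 g : X -> E, (forall x, sec (U x) (g x)) &
    forall x y, f x y = res (U x `&` U y) (g y) - res (U x `&` U y) (g x).

Definition res1 (V : X -> set X) (f : X -> X -> E) : X -> X -> E :=
  fun x y => res (V x `&` V y) (f x y).

(* The cocycles f on U and g on W have the same class in the colimit. *)
Definition cohomologous1 (U : X -> set X) (f : X -> X -> E)
    (W : X -> set X) (g : X -> X -> E) :=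
  exists V, [/\ pointed_cover V, refines V U, refines V W &
                coboundary1 V (res1 V f - res1 V g)].

(* Finitely many classes always have representatives on one common cover. *)
Definition H1_dim (n : nat) :=
  exists (U : X -> set X) (b : 'I_n -> X -> X -> E),
  [/\ pointed_cover U,
      forall i, cocycle1 U (b i),
      forall a : 'I_n -> F,
        cohomologous1 U (\sum_(i < n) a i *: b i) U 0 -> forall i, a i = 0 &
      forall W f, pointed_cover W -> cocycle1 W f ->
        exists a : 'I_n -> F, cohomologous1 W f U (\sum_(i < n) a i *: b i)].

End Cohomology.

(* A Z/2-graded presheaf is given by its even part (at [false]) and its odd
   part (at [true]). *)
Definition h0_is (F : fieldType) (X : topologicalType)
    (P : bool -> presheaf F X) (a b : nat) :=
  H0_dim (P false) a /\ H0_dim (P true) b.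

Definition h1_is (F : fieldType) (X : topologicalType)
    (P : bool -> presheaf F X) (a b : nat) :=
  H1_dim (P false) a /\ H1_dim (P true) b.

(** * The projective line with its Zariski topology *)

(* Algebraic model: the nonempty open sets are the cofinite sets of points.
   [Some z] is the point with coordinate z, [None] the point z = oo. *)
Definition P1 (F : Type) := option F.
HB.instance Definition _ (F : choiceType) := Choice.on (P1 F).

Section ZariskiP1.
Variable F : choiceType.

Definition zariski_open (U : set (P1 F)) := U = set0 \/ finite_set (~` U).

Let zariski_openT : zariski_open setT.
Proof. by right; rewrite setCT; exact: finite_set0. Qed.

Let zariski_openI : setI_closed zariski_open.
Proof.
move=> A B [->|fA]; first by rewrite set0I; left.
move=> [->|fB]; first by rewrite setI0; left.
by right; rewrite setCI finite_setU.
Qed.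

Let zariski_open_bigU (I : Type) (f : I -> set (P1 F)) :
  (forall i, zariski_open (f i)) -> zariski_open (\bigcup_i f i).
Proof.
move=> fo; have [[i fi]|nf] := pselect (exists i, finite_set (~` f i)).
  right; apply: sub_finite_set fi => x nx fx; apply: nx; by exists i.
left; apply/seteqP; split=> // x [i _ fix_].
case: (fo i) => [fi0|fi]; first by rewrite fi0 in fix_.
by case: nf; exists i.
Qed.

HB.instance Definition _ := isOpenTopological.Build (P1 F)
  zariski_openT zariski_openI zariski_open_bigU.
End ZariskiP1.

Section Charts.
Variable F : fieldType.

Definition chart0 (z : F) : P1 F := Some z.
Definition chart1 (w : F) : P1 F := if w == 0 then None else Some w^-1.

(* Regular functions on an open subset V of the affine line: V is covered by
   basic open sets {q != 0} on which f is a fraction p / q. Functions on the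
   set of closed points are adequate since F is meant to be algebraically
   closed. *)
Definition regular_on (V : set F) (f : F -> F) := forall a, V a ->
  exists p q : {poly F}, q.[a] != 0 /\
    forall z, V z -> q.[z] != 0 -> f z = p.[z] / q.[z].

End Charts.

Arguments chart0 {F} z.
Arguments chart1 {F} w.

(** * Exterior algebra on m odd generators *)

(* Coordinates in the basis theta_S = theta_i1 ... theta_ik, where
   S = {i1 < ... < ik}. *)
Definition ext (F : fieldType) (m : nat) := {ffun {set 'I_m} -> F^o}.

Section Ext.
Variables (F : fieldType) (m : nat).

(* theta_A theta_B = (-1)^(inversions A B) theta_(A :|: B), A, B disjoint *)
Definition inversions (A B : {set 'I_m}) : nat :=
  #|[pred ij : 'I_m * 'I_m | [&& ij.1 \in A, ij.2 \in B & (ij.2 < ij.1)%N]]|.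

Definition ext_mul (f g : ext F m) : ext F m :=
  [ffun S : {set 'I_m} => \sum_(A : {set 'I_m} | A \subset S)
     (-1) ^+ inversions A (S :\: A) * (f A * g (S :\: A))].

End Ext.

(** * The structure sheaf of P^{1|m} *)

(* A section is the pair of its expressions in the charts (z|theta) and
   (w|phi), extended by 0 outside of the open set over which it is defined. *)
Definition superfun (F : fieldType) (m : nat) :=
  ((F -> ext F m) * (F -> ext F m))%type.

Section StructureSheaf.
Variables (F : fieldType) (m : nat).
Local Notation S := (superfun F m).
Implicit Types (U V : set (P1 F)) (s t : S).

(* The last clause is the change of coordinates z = 1/w, theta_i = phi_i/w:
   it takes f(z) theta_A to f(1/w) w^(-#|A|) phi_A. *)
Definition O_sec U : set S := [set s : S |
  [/\ forall A, regular_on (chart0 @^-1` U) (fun z => s.1 z A),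
      forall A, regular_on (chart1 @^-1` U) (fun w => s.2 w A),
      forall z, ~ U (chart0 z) -> s.1 z = 0,
      forall w, ~ U (chart1 w) -> s.2 w = 0 &
      forall w : F, w != 0 -> U (chart1 w) ->
        forall A : {set 'I_m}, s.2 w A = w ^- #|A| * s.1 w^-1 A]].

Definition O_res V s : S :=
  (fun z => if `[< V (chart0 z) >] then s.1 z else 0,
   fun w => if `[< V (chart1 w) >] then s.2 w else 0).

Definition O_mul s t : S :=
  (fun z => ext_mul (s.1 z) (t.1 z), fun w => ext_mul (s.2 w) (t.2 w)).

Definition O_homog (p : bool) s := forall (x : F) (A : {set 'I_m}),
  odd #|A| != p -> s.1 x A = 0 /\ s.2 x A = 0.

Lemma regular_on_linear (V : set F) (a : F) (f g : F -> F) :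
  regular_on V f -> regular_on V g -> regular_on V (fun x => a * f x + g x).
Proof.
move=> rf rg x Vx.
have [p [q [q0 pq]]] := rf x Vx; have [p' [q' [q'0 pq']]] := rg x Vx.
exists (a *: (p * q') + p' * q), (q * q').
rewrite hornerM mulf_neq0//; split=> // z Vz; rewrite hornerM mulf_eq0 negb_or.
move=> /andP[qz q'z]; rewrite pq// pq'// hornerD !hornerM hornerZ hornerM.
by field; rewrite qz q'z.
Qed.

Lemma O_sec_linear V (a : F) s t :
  O_sec V s -> O_sec V t -> O_sec V (a *: s + t).
Proof.
move=> [s1 s2 s3 s4 s5] [t1 t2 t3 t4 t5]; split.
- move=> A; under eq_fun do rewrite /= !ffunE.
  exact: regular_on_linear (s1 A) (t1 A).
- move=> A; under eq_fun do rewrite /= !ffunE.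
  exact: regular_on_linear (s2 A) (t2 A).
- by move=> z Vz /=; rewrite !fctE s3// t3// scaler0 addr0.
- by move=> z Vz /=; rewrite !fctE s4// t4// scaler0 addr0.
- move=> w w0 Vw A /=; rewrite !fctE !ffunE s5// t5// mulrDr; congr (_ + _).
  exact: mulrCA.
Qed.

Lemma O_sec0 V : O_sec V 0.
Proof.
have r0 W : regular_on W (fun=> 0 : F).
  by move=> x _; exists 0, 1; split=> [|z _ _]; rewrite !hornerE ?oner_neq0 ?mul0r.
split=> [A|A|//|//|w w0 _ A] /=.
- by under eq_fun do rewrite ffunE; exact: r0.
- by under eq_fun do rewrite ffunE; exact: r0.
- by rewrite !ffunE mulr0.
Qed.

Lemma O_res_linear V (a : F) s t :
  O_res V (a *: s + t) = a *: O_res V s + O_res V t.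
Proof.
congr pair; apply/funext => x /=; rewrite !fctE;
  by case: ifP => // _; rewrite scaler0 addr0.
Qed.

Lemma ext_mulDl (a : F) (f g h : ext F m) :
  ext_mul (a *: f + g) h = a *: ext_mul f h + ext_mul g h.
Proof.
apply/ffunP => A; rewrite !ffunE scaler_sumr -big_split/=.
apply: eq_bigr => B _; rewrite !ffunE !mulrDl mulrDr; congr (_ + _).
by rewrite -[a *: f B]/(a * f B) -[RHS]/(a * _) -mulrA mulrCA.
Qed.

Lemma ext_mulDr (a : F) (f g h : ext F m) :
  ext_mul h (a *: f + g) = a *: ext_mul h f + ext_mul h g.
Proof.
apply/ffunP => A; rewrite !ffunE scaler_sumr -big_split/=.
apply: eq_bigr => B _; rewrite !ffunE !mulrDr; congr (_ + _).
rewrite -[a *: f _]/(a * f _) -[RHS]/(a * _).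
by rewrite [RHS]mulrCA [h B * (a * _)]mulrCA.
Qed.

Lemma O_mulDl (a : F) s t u :
  O_mul (a *: s + t) u = a *: O_mul s u + O_mul t u.
Proof. by congr pair; apply/funext => x /=; rewrite !fctE ext_mulDl. Qed.

Lemma O_mulDr (a : F) s t u :
  O_mul u (a *: s + t) = a *: O_mul u s + O_mul u t.
Proof. by congr pair; apply/funext => x /=; rewrite !fctE ext_mulDr. Qed.

Lemma O_mul0l u : O_mul 0 u = 0.
Proof. by have := O_mulDl (-1) 0 0 u; rewrite scaler0 addr0 scaleN1r addNr. Qed.

Lemma O_mul0r u : O_mul u 0 = 0.
Proof. by have := O_mulDr (-1) 0 0 u; rewrite scaler0 addr0 scaleN1r addNr. Qed.

(** * The tangent sheaf: superderivations of the structure sheaf *)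

(* A superderivation of parity p of the restriction of O to U is a family of
   F-linear maps D V : O(V) -> O(V), V open in U, compatible with restriction.
   As D is a total function, it is set to 0 wherever it is not meaningful. *)
Definition T_sec (p : bool) U : set (set (P1 F) -> S -> S) := [set D : set (P1 F) -> S -> S |
  [/\ forall V s, ~ [/\ open V, V `<=` U & O_sec V s] -> D V s = 0,
      forall V W s, open V -> V `<=` U -> open W -> W `<=` V -> O_sec V s ->
        D W (O_res W s) = O_res W (D V s) &
      forall V, open V -> V `<=` U ->
      [/\ forall s, O_sec V s -> O_sec V (D V s),
          forall (a : F) s t, O_sec V s -> O_sec V t ->
            D V (a *: s + t) = a *: D V s + D V t,
          forall q s, O_sec V s -> O_homog q s -> O_homog (p (+) q) (D V s) &
          forall q s t, O_sec V s -> O_sec V t -> O_homog q s ->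
            D V (O_mul s t) =
              O_mul (D V s) t + (-1) ^+ (p && q) *: O_mul s (D V t)]]].

Definition T_res V (D : set (P1 F) -> S -> S) : set (P1 F) -> S -> S :=
  fun W s => if `[< W `<=` V >] then D W s else 0.


Lemma T_sec0 p U : T_sec p U 0.
Proof.
split=> //.
  move=> V W s _ _ _ _ _; congr pair; apply/funext => x /=; by case: ifP.
move=> V oV VU; split.
- by move=> s _; exact: O_sec0.
- by move=> a s t _ _; rewrite /= scaler0 addr0.
- by move=> q s _ _ x A _ /=; rewrite !ffunE.
- by move=> q s t _ _ _; rewrite /= O_mul0l O_mul0r scaler0 addr0.
Qed.

Lemma T_sec_linear p U (a : F) D D' :
  T_sec p U D -> T_sec p U D' -> T_sec p U (a *: D + D').
Proof.
move=> [D1 D2 D3] [E1 E2 E3]; split.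
- by move=> V s nVs; rewrite !fctE D1// E1// scaler0 addr0.
- by move=> V W s oV VU oW WV sV; rewrite !fctE O_res_linear (D2 V)// (E2 V).
move=> V oV VU; have [D4 D5 D6 D7] := D3 V oV VU.
have [E4 E5 E6 E7] := E3 V oV VU; split.
- by move=> s sV; apply: O_sec_linear; [exact: D4|exact: E4].
- move=> b s t sV tV; rewrite !fctE D5// E5// !scalerDr !scalerA.
  by rewrite [a * b]mulrC addrACA.
- move=> q s sV sq x A Aq; have [d1 d2] := D6 q s sV sq x A Aq.
  have [e1 e2] := E6 q s sV sq x A Aq.
  by rewrite /= !fctE !ffunE d1 d2 e1 e2 scaler0 addr0.
- move=> q s t sV tV sq; rewrite !fctE (D7 q)// (E7 q)// O_mulDl O_mulDr.
  by rewrite !scalerDr !scalerA [a * _]mulrC addrACA.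
Qed.

Lemma T_res_linear V (a : F) D D' :
  T_res V (a *: D + D') = a *: T_res V D + T_res V D'.
Proof.
apply/funext => W; apply/funext => s; rewrite /T_res !fctE.
by case: ifP => // _; rewrite scaler0 addr0.
Qed.

Lemma T_res_sec p U V D : V `<=` U -> T_sec p U D -> T_sec p V (T_res V D).
Proof.
move=> VU [D1 D2 D3].
have rT W s : W `<=` V -> T_res V D W s = D W s.
  by move=> WV; rewrite /T_res asboolT.
split.
- move=> W s nWs; rewrite /T_res; case: asboolP => // WV.
  by apply: D1 => -[oW _ sW]; exact: nWs.
- move=> W W' s oW WV oW' W'W sW; rewrite !rT//; last exact: subset_trans WV.
  by apply: D2 => //; exact: subset_trans VU.
move=> W oW WV; have [D4 D5 D6 D7] := D3 W oW (subset_trans WV VU); split.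
- by move=> s; rewrite rT//; exact: D4.
- by move=> a s t; rewrite !rT//; exact: D5.
- by move=> q s; rewrite !rT//; exact: D6.
- by move=> q s t; rewrite !rT//; exact: D7.
Qed.

Lemma T_res_id p U D : T_sec p U D -> T_res U D = D.
Proof.
move=> [D1 _ _]; apply/funext => W; apply/funext => s; rewrite /T_res.
by case: asboolP => // WU; rewrite D1// => -[].
Qed.

Lemma T_res_res V W D : W `<=` V -> T_res W (T_res V D) = T_res W D.
Proof.
move=> WV; apply/funext => W'; apply/funext => s; rewrite /T_res.
by case: asboolP => // W'W; rewrite asboolT//; exact: subset_trans WV.
Qed.

(* The tangent sheaf of P^{1|m}: even derivations at false, odd at true. *)
Definition tangent (p : bool) : presheaf F (P1 F) :=
  @Presheaf F (P1 F) (set (P1 F) -> S -> S) (T_sec p) T_res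
    (fun U _ => conj (T_sec0 p U) (@T_sec_linear p U)) T_res_linear
    (fun U V D _ _ => @T_res_sec p U V D) (fun U D _ => @T_res_id p U D)
    T_res_res.

End StructureSheaf.

Arguments tangent F m p : clear implicits.

(* Main.v *)
Require Import Defs.
From mathcomp Require Import all_boot all_algebra.
From mathcomp Require Import all_classical reals topology.
From mathcomp Require Import ring.
Set Implicit Arguments.
Unset Strict Implicit.
Unset Printing Implicit Defensive.
Import GRing.Theory.
Local Open Scope classical_set_scope.
Local Open Scope ring_scope.

(** A superderivation of the structure sheaf over an open set is a vector
   field: on the chart (z|theta_1, theta_2) it acts as
   f d/dz + g_1 d/dtheta_1 + g_2 d/dtheta_2, where f, g_1, g_2 are its values
   on the coordinates. For a derivation that kills the coordinates also kills
   the Grassmann algebra of constants and z - a, hence its value at the point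
   a of u = u(a) + (z - a) w is zero ([derivation_eq0]); subtracting a vector
   field gives the general case ([superderivation_vfield]). All coefficients
   are regular functions, that is, locally fractions of polynomials, and in
   the chart at infinity they become
     - w^2 f(1/w)   and   w g_i(1/w) - w^2 f(1/w) theta_i,
   where theta_A is rewritten as w^(-#|A|) phi_A.

   A global field has coefficients that are regular on the whole affine line,
   i.e. polynomials, and regularity at w = 0 bounds their degrees. Let f_A and
   g_(i,A) be the coefficients of theta_A in f and g_i. In the even case f_0
   has degree at most 2, the linear parts g_(i,j) are constants plus the
   leading coefficient of f_0 times z on the diagonal, and f_12 is a constant:
   3 + 4 + 1 = 8 parameters. In the odd case f_1, f_2, g_(1,0), g_(2,0) have
   degree at most 1 and determine g_(1,12), g_(2,12): again 8 parameters
   ([even_surj], [odd_surj]).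

   For the first cohomology, the point is that the principal part at a of a
   rational function, a polynomial in 1/(z - a) without constant term, is w
   times a regular function near infinity. This extra zero compensates the
   worst factor w^(-1) above, so the vector field with the principal parts of
   given coefficients is regular on the complement of a
   ([mittag_leffler]). Given a cocycle f on a cover (U_x), finitely many points
   lie outside U_oo; a single field k with the right principal parts there
   makes all the sections k + f(oo, x) of T over the intersections of U_oo and
   U_x extend to x, and these extensions bound the cocycle
   ([mittag_leffler_H1]). *)

(** * Germs of rational functions *)

Section RationalGerms.
Variable F : closedFieldType.
Implicit Types (f g h : F -> F) (p q : {poly F}) (a d z : F).

Lemma horner1 a : (1 : {poly F}).[a] = 1.
Proof. exact: hornerC. Qed.

Local Notation hE := (hornerD, hornerN, hornerX, hornerC, hornerZ, hornerM,
  horner_exp, horner1, horner0).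

Lemma closed_field_infinite : infinite_set [set: F].
Proof.
move=> /finite_seqP[s sE].
have mem z : z \in s by move: (I : [set: F] z); rewrite sE.
pose r := undup s.
have ur : uniq r by exact: undup_uniq.
have memr z : z \in r by rewrite mem_undup.
pose P : {poly F} := \prod_(x <- r) ('X - x%:P).
have sP : size P = (size r).+1 by exact: size_prod_XsubC.
have r0 : (0 < size r)%N by case: (r) (memr 0).
have : exists x, root (P + 1) x.
  apply/closed_rootP; rewrite size_polyDl sP ?size_poly1 ?ltnS//.
  by rewrite eqSS -lt0n.
move=> [x]; rewrite /root hornerD hornerE.
have /eqP -> : P.[x] == 0 by rewrite -[_ == 0]/(root P x) root_prod_XsubC.
by rewrite add0r oner_eq0.
Qed.

(** Nonempty Zariski open sets of the line are cofinite, so this is the filter of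
   generic points. *)
Definition cofin : set_system F := @frechet_filter F.

Global Instance cofin_proper : ProperFilter cofin :=
  frechet_properfilter closed_field_infinite.

Lemma cofinP (P : set F) : finite_set (~` P) -> \forall z \near cofin, P z.
Proof. by []. Qed.

Lemma cofin_neq a : \forall z \near cofin, z != a.
Proof.
apply: cofinP; rewrite (_ : ~` _ = [set a]); first exact: finite_set1.
by apply/seteqP; split=> z /= => [/negP/negPn/eqP|->]//; rewrite eqxx.
Qed.

Lemma cofin_horner q : q != 0 -> \forall z \near cofin, q.[z] != 0.
Proof.
move=> q0; have [r qE] := closed_field_poly_normal q.
apply: cofinP; apply: sub_finite_set (finite_seq r) => z /= /negP/negPn.
rewrite -[_ == 0]/(root q z) qE rootZ ?lead_coef_eq0//.
by rewrite root_prod_XsubC.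
Qed.

Lemma cofin_poly_eq p q : (\forall z \near cofin, p.[z] = q.[z]) -> p = q.
Proof.
move=> pq; apply/eqP; rewrite -subr_eq0; apply: contraT => /cofin_horner rn.
have [z [pqz /eqP[]]] := filter_ex (filterI pq rn).
by rewrite hornerD hornerN pqz subrr.
Qed.

(** Membership in the local ring at [a], together with the value of the formal
   derivative there. Only the behaviour of [f] at [a] and at almost all other
   points is constrained, so that extending a section by zero does no harm. *)
Definition has_deriv f a d := exists p q,
  [/\ q.[a] != 0, f a = p.[a] / q.[a],
      d = (p^`().[a] * q.[a] - p.[a] * q^`().[a]) / q.[a] ^+ 2 &
      \forall z \near cofin, f z = p.[z] / q.[z]].

Lemma hornerN0 q a : q.[a] != 0 -> q != 0.
Proof. by apply: contraNneq => ->; rewrite horner0. Qed.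

(** The identity principle: two fractions that agree generically satisfy a
   polynomial identity p s = r q, whose value and derivative at [a] give both
   conclusions. *)
Lemma has_deriv_eq f g a d e : has_deriv f a d -> has_deriv g a e ->
  (\forall z \near cofin, f z = g z) -> f a = g a /\ d = e.
Proof.
move=> [p [q [q0 -> -> fpq]]] [r [s [s0 -> -> grs]]] fg.
have psqr : p * s = r * q.
  apply: cofin_poly_eq.
  have qn := cofin_horner (hornerN0 q0); have sn := cofin_horner (hornerN0 s0).
  near=> z; rewrite !hornerM.
  have qz : q.[z] != 0 by near: z.
  have sz : s.[z] != 0 by near: z.
  have : p.[z] / q.[z] = r.[z] / s.[z].
    have <- : f z = p.[z] / q.[z] by near: z.
    have <- : g z = r.[z] / s.[z] by near: z.
    by near: z.
  by move/eqP; rewrite eqr_div// => /eqP.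
have val : p.[a] * s.[a] = r.[a] * q.[a] by rewrite -!hornerM psqr.
have der : p^`().[a] * s.[a] + p.[a] * s^`().[a] =
           r^`().[a] * q.[a] + r.[a] * q^`().[a].
  by rewrite -!hornerM -!hornerD -!derivM psqr.
have pa : p.[a] = r.[a] * q.[a] / s.[a] by rewrite -val mulfK.
split; first by apply/eqP; rewrite eqr_div//; apply/eqP.
have dpa : p^`().[a] = (r^`().[a] * q.[a] + r.[a] * q^`().[a]
    - p.[a] * s^`().[a]) / s.[a] by rewrite -der addrK mulfK.
by rewrite dpa pa; field; rewrite q0 s0.
Unshelve. all: by end_near.
Qed.

Lemma has_deriv_unique f a d e : has_deriv f a d -> has_deriv f a e -> d = e.
Proof.
by move=> fd fe; have [_ ->] := has_deriv_eq fd fe (filterE _ (fun z => erefl)).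
Qed.

Lemma has_deriv_congr f g a d : f a = g a ->
  (\forall z \near cofin, f z = g z) -> has_deriv f a d -> has_deriv g a d.
Proof.
move=> fga fg [p [q [q0 fa -> fpq]]]; exists p, q; split; rewrite -?fga//.
near=> z; have <- : f z = g z by near: z.
by near: z.
Unshelve. all: by end_near.
Qed.

Lemma has_deriv_frac p q a : q.[a] != 0 ->
  has_deriv (fun z => p.[z] / q.[z]) a
    ((p^`().[a] * q.[a] - p.[a] * q^`().[a]) / q.[a] ^+ 2).
Proof. by move=> q0; exists p, q; split=> //; apply: filterE. Qed.

Lemma has_deriv_poly p a : has_deriv (horner p) a p^`().[a].
Proof.
exists p, 1; rewrite !hE oner_eq0; split=> //.
- by rewrite ?divr1.
- by rewrite derivC !hE ?(mulr0, subr0, expr1n, divr1, mulr1, oppr0, addr0).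
by apply: filterE => z; rewrite !hE ?divr1.
Qed.

Lemma has_deriv_cst c a : has_deriv (fun=> c) a 0.
Proof.
have -> : (fun=> c) = horner c%:P by apply/funext => z; rewrite hornerC.
by have := has_deriv_poly c%:P a; rewrite derivC horner0.
Qed.

Lemma has_deriv_id a : has_deriv id a 1.
Proof.
have -> : id = horner ('X : {poly F}) by apply/funext => z; rewrite hornerX.
by have := has_deriv_poly 'X a; rewrite derivX hornerC.
Qed.

Lemma has_derivD f g a d e : has_deriv f a d -> has_deriv g a e ->
  has_deriv (fun z => f z + g z) a (d + e).
Proof.
move=> [p [q [q0 fa -> fpq]]] [r [s [s0 ga -> grs]]].
exists (p * s + r * q), (q * s).
have qn := cofin_horner (hornerN0 q0); have sn := cofin_horner (hornerN0 s0).
split.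
- by rewrite hornerM mulf_neq0.
- by rewrite fa ga !hE; field; rewrite q0 s0.
- by rewrite !derivE !hE; field; rewrite q0 s0.
near=> z; rewrite !hE.
have -> : f z = p.[z] / q.[z] by near: z.
have -> : g z = r.[z] / s.[z] by near: z.
have qz : q.[z] != 0 by near: z.
have sz : s.[z] != 0 by near: z.
by field; rewrite qz sz.
Unshelve. all: by end_near.
Qed.

Lemma has_derivM f g a d e : has_deriv f a d -> has_deriv g a e ->
  has_deriv (fun z => f z * g z) a (d * g a + f a * e).
Proof.
move=> [p [q [q0 fa -> fpq]]] [r [s [s0 ga -> grs]]].
exists (p * r), (q * s); rewrite fa ga.
split.
- by rewrite hornerM mulf_neq0.
- by rewrite !hE; field; rewrite q0 s0.
- by rewrite !derivE !hE; field; rewrite q0 s0.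
near=> z; rewrite !hE.
have -> : f z = p.[z] / q.[z] by near: z.
have -> : g z = r.[z] / s.[z] by near: z.
by rewrite invfM mulrACA.
Unshelve. all: by end_near.
Qed.

Lemma has_derivZ c f a d : has_deriv f a d ->
  has_deriv (fun z => c * f z) a (c * d).
Proof.
by move=> fd; have := has_derivM (has_deriv_cst c a) fd; rewrite mul0r add0r.
Qed.

Lemma has_derivN f a d : has_deriv f a d -> has_deriv (fun z => - f z) a (- d).
Proof.
move/(has_derivZ (-1)); rewrite mulN1r.
by under eq_fun do rewrite mulN1r.
Qed.

Lemma has_derivV f a d : f a != 0 -> has_deriv f a d ->
  has_deriv (fun z => (f z)^-1) a (- d / f a ^+ 2).
Proof.
move=> fa0 [p [q [q0 fa -> fpq]]].
have p0 : p.[a] != 0 by apply: contraNneq fa0 => p0; rewrite fa p0 mul0r.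
exists q, p; split=> //.
- by rewrite fa invf_div.
- by rewrite fa; field; rewrite q0 p0.
by near=> z; rewrite -invf_div; congr (_^-1); near: z.
Unshelve. all: by end_near.
Qed.

Lemma has_deriv_sum (I : Type) (r : seq I) (P : pred I) (f : I -> F -> F)
    (d : I -> F) a :
  (forall i, P i -> has_deriv (f i) a (d i)) ->
  has_deriv (fun z => \sum_(i <- r | P i) f i z) a (\sum_(i <- r | P i) d i).
Proof.
move=> fd; elim: r => [|i r IH].
  rewrite big_nil; under eq_fun do rewrite big_nil; exact: has_deriv_cst.
rewrite big_cons; under eq_fun do rewrite big_cons.
by case: ifP => // Pi; apply: has_derivD => //; exact: fd.
Qed.

Lemma has_deriv_comp_inv f a d : a != 0 -> has_deriv f a^-1 d ->
  has_deriv (fun z => f z^-1) a (- d / a ^+ 2).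
Proof.
move=> a0.
have polyV p : has_deriv (fun z => p.[z^-1]) a (- p^`().[a^-1] / a ^+ 2).
  elim/poly_ind: p => [|p c IH].
    rewrite derivC horner0 oppr0 mul0r.
    under eq_fun do rewrite horner0; exact: has_deriv_cst.
  under eq_fun do rewrite !hE.
  have -> : - (p * 'X + c%:P)^`().[a^-1] / a ^+ 2 =
    (- p^`().[a^-1] / a ^+ 2 * a^-1 + p.[a^-1] * (- 1 / a ^+ 2)) + 0.
    by rewrite !derivE !hE; field.
  apply: has_derivD (has_deriv_cst _ _); apply: has_derivM => //.
  exact: has_derivV (has_deriv_id _).
move=> [p [q [q0 fa -> fpq]]].
suff: has_deriv (fun z => p.[z^-1] * (q.[z^-1])^-1) a
   (- ((p^`().[a^-1] * q.[a^-1] - p.[a^-1] * q^`().[a^-1]) / q.[a^-1] ^+ 2)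
     / a ^+ 2).
  apply: has_deriv_congr => //; near=> z.
  suff : f z^-1 = p.[z^-1] / q.[z^-1] by [].
  near: z.
  apply: cofinP; apply: (finite_preimage (f := @GRing.inv F)) fpq.
  by move=> x y _ _; exact: invr_inj.
have -> : - ((p^`().[a^-1] * q.[a^-1] - p.[a^-1] * q^`().[a^-1]) /
   q.[a^-1] ^+ 2) / a ^+ 2 =
   (- p^`().[a^-1] / a ^+ 2) * (q.[a^-1])^-1 +
   p.[a^-1] * (- (- q^`().[a^-1] / a ^+ 2) / q.[a^-1] ^+ 2).
  by field; rewrite a0 q0.
by apply: has_derivM => //; exact: has_derivV.
Unshelve. all: by end_near.
Qed.

Definition regular_at f a := exists d, has_deriv f a d.

Lemma regular_at_congr f g a : f a = g a ->
  (\forall z \near cofin, f z = g z) -> regular_at f a -> regular_at g a.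
Proof. by move=> fga fg [d fd]; exists d; exact: has_deriv_congr fd. Qed.

Lemma regular_at_eq f g a : regular_at f a -> regular_at g a ->
  (\forall z \near cofin, f z = g z) -> f a = g a.
Proof. by move=> [d fd] [e ge] fg; have [] := has_deriv_eq fd ge fg. Qed.

Lemma regular_at_cst c a : regular_at (fun=> c) a.
Proof. by exists 0; exact: has_deriv_cst. Qed.

Lemma regular_at_id a : regular_at id a.
Proof. by exists 1; exact: has_deriv_id. Qed.

Lemma regular_at_poly p a : regular_at (horner p) a.
Proof. by exists p^`().[a]; exact: has_deriv_poly. Qed.

Lemma regular_atD f g a : regular_at f a -> regular_at g a ->
  regular_at (fun z => f z + g z) a.
Proof. by move=> [d fd] [e ge]; exists (d + e); exact: has_derivD. Qed.

Lemma regular_atM f g a : regular_at f a -> regular_at g a ->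
  regular_at (fun z => f z * g z) a.
Proof.
by move=> [d fd] [e ge]; exists (d * g a + f a * e); exact: has_derivM.
Qed.

Lemma regular_atN f a : regular_at f a -> regular_at (fun z => - f z) a.
Proof. by move=> [d fd]; exists (- d); exact: has_derivN. Qed.

Lemma regular_atV f a : f a != 0 -> regular_at f a ->
  regular_at (fun z => (f z)^-1) a.
Proof. by move=> f0 [d fd]; exists (- d / f a ^+ 2); exact: has_derivV. Qed.

Lemma regular_atX f n a : regular_at f a -> regular_at (fun z => f z ^+ n) a.
Proof.
move=> rf; elim: n => [|n IH]; first exact: regular_at_cst.
by under eq_fun do rewrite exprS; exact: regular_atM.
Qed.

Lemma regular_at_sum (I : Type) (r : seq I) (P : pred I) (f : I -> F -> F) a :
  (forall i, P i -> regular_at (f i) a) ->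
  regular_at (fun z => \sum_(i <- r | P i) f i z) a.
Proof.
move=> fd; elim: r => [|i r IH].
  under eq_fun do rewrite big_nil; exact: regular_at_cst.
under eq_fun do rewrite big_cons.
case Pi: (P i) => //; apply: regular_atD => //; exact: fd.
Qed.

Lemma regular_at_frac p q a : q.[a] != 0 ->
  regular_at (fun z => p.[z] / q.[z]) a.
Proof. by move=> q0; eexists; exact: has_deriv_frac. Qed.

Lemma regular_at_comp_inv f a : a != 0 -> regular_at f a^-1 ->
  regular_at (fun z => f z^-1) a.
Proof. by move=> a0 [d fd]; eexists; exact: has_deriv_comp_inv fd. Qed.

(** Any fraction that represents [f] near one point of [V] represents it generically,
   hence at each point of [V] where its denominator does not vanish. *)
Lemma regular_onP (V : set F) f : finite_set (~` V) ->
  regular_on V f <-> forall a, V a -> regular_at f a.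
Proof.
move=> fV; split=> [rf a Va|rf a Va].
  have [p [q [q0 fpq]]] := rf a Va.
  apply: regular_at_congr (regular_at_frac p q0); first by rewrite fpq.
  have qn := cofin_horner (hornerN0 q0).
  have Vn : \forall z \near cofin, V z := fV.
  by near=> z; rewrite fpq//; near: z.
have [d [p [q [q0 fa _ fpq]]]] := rf a Va.
exists p, q; split=> // z Vz qz; apply: (@regular_at_eq f (fun z => p.[z] / q.[z])) => //.
  exact: rf.
exact: regular_at_frac.
Unshelve. all: by end_near.
Qed.

Definition der f a : F := xget 0 [set d | has_deriv f a d].

Lemma derE f a d : has_deriv f a d -> der f a = d.
Proof.
move=> fd; apply: xget_unique => // e fe; exact: has_deriv_unique fe fd.
Qed.

Lemma derP f a : regular_at f a -> has_deriv f a (der f a).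
Proof. by move=> [d fd]; rewrite (derE fd). Qed.

Lemma der_congr f g a : f a = g a ->
  (\forall z \near cofin, f z = g z) -> der f a = der g a.
Proof.
move=> fga fg; rewrite /der; congr (xget _ _); apply/seteqP; split=> d /=.
  exact: has_deriv_congr.
apply: has_deriv_congr => //.
by near=> z; symmetry; near: z.
Unshelve. all: by end_near.
Qed.

(** A fraction p / q for [f] gives (p' q - p q') / q^2 for its derivative,
   simultaneously at almost all points. *)
Lemma regular_at_der f a :
  (\forall z \near cofin, regular_at f z) -> regular_at f a ->
  regular_at (der f) a.
Proof.
move=> fn [d fd]; have [p [q [q0 fa dE fpq]]] := fd.
apply: regular_at_congr (@regular_at_frac (p^`() * q - p * q^`()) (q ^+ 2) a _).
- by rewrite (derE fd) dE !hE.
- have qn := cofin_horner (hornerN0 q0).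
  near=> z; rewrite !hE; symmetry.
  have fz : regular_at f z by near: z.
  have qz : q.[z] != 0 by near: z.
  by have [_] := has_deriv_eq (derP fz) (has_deriv_frac p qz) fpq.
- by rewrite horner_exp expf_neq0.
Unshelve. all: by end_near.
Qed.

(** Hadamard's lemma, the source of the determination of derivations by their
   values on coordinates. *)
Lemma regular_factor (V : set F) f a : finite_set (~` V) -> V a ->
  (forall z, V z -> regular_at f z) ->
  exists2 g : F -> F, forall z, V z -> regular_at g z &
    forall z, f z = f a + (z - a) * g z.
Proof.
move=> fV Va rf; have [d [p [q [q0 fa _ fpq]]]] := rf a Va.
pose P := p - (f a)%:P * q.
have P0 : root P a by rewrite /root !hE fa; apply/eqP; field.
have [Q PQ] := factor_theorem _ _ P0.
exists (fun z => if z == a then Q.[a] / q.[a] else (f z - f a) / (z - a));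
  last first.
  move=> z; case: eqVneq => [->|za]; first by rewrite subrr mul0r addr0.
  by rewrite mulrC divfK ?subr_eq0// addrC subrK.
have qn := cofin_horner (hornerN0 q0).
have na := cofin_neq a.
move=> z Vz; case: (eqVneq z a) => [->|za].
  apply: regular_at_congr (regular_at_frac Q q0); first by rewrite eqxx.
  near=> y.
  have ya : y != a by near: y.
  have qy : q.[y] != 0 by near: y.
  have fy : f y = p.[y] / q.[y] by near: y.
  have ya' : y - a != 0 by rewrite subr_eq0.
  rewrite (negbTE ya); apply: (mulIf ya'); rewrite divfK//.
  have : P.[y] = Q.[y] * (y - a) by rewrite PQ !hE.
  by rewrite mulrAC => <-; rewrite fy /P !hE; field.
apply: regular_at_congr
  (_ : regular_at (fun z => (f z - f a) * (z - a)^-1) z).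
- by rewrite (negbTE za).
- by near=> y; rewrite ifF//; apply/negbTE; near: y.
apply: regular_atM.
  by apply: regular_atD; [exact: rf|exact: regular_at_cst].
apply: regular_atV; first by rewrite subr_eq0.
by apply: regular_atD; [exact: regular_at_id|exact: regular_at_cst].
Unshelve. all: by end_near.
Qed.

(** In lowest terms the denominator has no root at all: at a root, comparison with
   a local fraction would make the numerator vanish too. *)
Lemma regular_everywhere f : (forall a, regular_at f a) ->
  exists p, f =1 horner p.
Proof.
move=> rf; have [d [p [q [q0 _ _ fpq]]]] := rf 0.
have qn0 := hornerN0 q0.
pose g := gcdp p q; have g0 : g != 0 by rewrite gcdp_eq0 negb_and qn0 orbT.
have [pE qE] : p = p %/ g * g /\ q = q %/ g * g.
  by rewrite !divpK ?dvdp_gcdl ?dvdp_gcdr.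
set p1 := p %/ g in pE; set q1 := q %/ g in qE.
have cop : coprimep p1 q1 by apply: coprimep_div_gcd; rewrite qn0 orbT.
have f1 : \forall z \near cofin, f z = p1.[z] / q1.[z].
  have gn := cofin_horner g0; near=> z.
  have -> : f z = p.[z] / q.[z] by near: z.
  have gz : g.[z] != 0 by near: z.
  by rewrite pE qE !hornerM invfM mulrACA divff// mulr1.
have q1n0 : q1 != 0 by apply: contraNneq qn0 => q10; rewrite qE q10 mul0r.
have noroot x : q1.[x] != 0.
  apply/negP => q1x.
  have [_ [r [s [s0 _ _ frs]]]] := rf x.
  have E : p1 * s = r * q1.
    apply: cofin_poly_eq.
    have sn := cofin_horner (hornerN0 s0); have q1n := cofin_horner q1n0.
    near=> z; rewrite !hornerM.
    have q1z : q1.[z] != 0 by near: z.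
    have sz : s.[z] != 0 by near: z.
    apply/eqP; rewrite -eqr_div//; apply/eqP.
    have <- : f z = p1.[z] / q1.[z] by near: z.
    by near: z.
  have : (p1 * s).[x] = 0 by rewrite E hornerM (eqP q1x) mulr0.
  move/eqP; rewrite hornerM mulf_eq0 (negbTE s0) orbF => p1x.
  by have := coprimep_root cop p1x; rewrite q1x.
have [c qc] : exists c, q1 = c%:P.
  exists q1`_0; apply: size1_polyC; rewrite leq_eqVlt.
  case: (boolP (size q1 == 1)) => //= /closed_rootP[x].
  by rewrite /root (negbTE (noroot x)).
exists (c^-1 *: p1) => z.
apply: (@regular_at_eq f (horner (c^-1 *: p1))) => //.
  exact: regular_at_poly.
near=> y; rewrite !hE mulrC.
have -> : f y = p1.[y] / q1.[y] by near: y.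
by rewrite qc hornerC.
Unshelve. all: by end_near.
Qed.

(** Otherwise w^(n - k) h(w), with n the degree of [p], vanishes at 0, while it is
   the reversed polynomial w^n p(1/w), whose value at 0 is the leading
   coefficient. *)
Lemma size_growth p k h : regular_at h 0 ->
  (\forall w \near cofin, h w = w ^+ k * p.[w^-1]) -> (size p <= k.+1)%N.
Proof.
move=> rh hE; rewrite leqNgt; apply/negP => kp.
pose n := (size p).-1; have np : size p = n.+1 by rewrite prednK// (leq_trans _ kp).
have kn : (k < n)%N by rewrite np ltnS in kp.
pose r := \poly_(i < n.+1) p`_(n - i).
have rE w : w != 0 -> r.[w] = w ^+ n * p.[w^-1].
  move=> w0; rewrite horner_poly (@horner_coef_wide _ n.+1) ?np// mulr_sumr.
  rewrite (reindex_inj rev_ord_inj)/=; apply: eq_bigr => i _.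
  rewrite subSS subKn -1?ltnS// mulrCA exprVn -expfB_cond//.
  by rewrite (negbTE w0) add0n -ltnS.
have : (fun w => w ^+ (n - k) * h w) 0 = r.[0].
  apply: (@regular_at_eq (fun w => w ^+ (n - k) * h w) (horner r)); last 1 first.
  - have n0 := cofin_neq 0; near=> w.
    have w0 : w != 0 by near: w.
    have -> : h w = w ^+ k * p.[w^-1] by near: w.
    by rewrite rE// mulrA -exprD subnK// ltnW.
  - by apply: regular_atM => //; apply: regular_atX; exact: regular_at_id.
  - exact: regular_at_poly.
rewrite /= expr0n subn_eq0 leqNgt kn mul0r horner_coef0 coef_poly subn0 /=.
move/esym/eqP; rewrite -[n]/(size p).-1 -lead_coefE lead_coef_eq0 => /eqP p0.
by rewrite p0 size_poly0 in np.
Unshelve. all: by end_near.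
Qed.

(** By Bezout, f = c / s + t / (z - a)^n with s(a) nonzero and t of degree less
   than n; the last term is - k. The gain of a factor [w] at infinity comes from
   this strict inequality. The last clause preserves parities when the lemma is
   applied coefficientwise to a homogeneous vector field. *)
Lemma principal_part f a : (\forall z \near cofin, regular_at f z) ->
  exists k r e : F -> F,
  [/\ forall z, z != a -> regular_at k z,
      forall w, w * a != 1 -> regular_at r w,
      forall w, w != 0 -> k w^-1 = w * r w,
      regular_at e a &
      \forall z \near cofin, e z = k z + f z] /\
  ((\forall z \near cofin, f z = 0) -> k =1 (fun=> 0) /\ r =1 (fun=> 0)).
Proof.
move=> rf; have [f0|f0] := pselect (\forall z \near cofin, f z = 0).
  exists (fun=> 0), (fun=> 0), (fun=> 0); split=> //.
  split=> [z _|w _|w _||]; rewrite ?mulr0//; try exact: regular_at_cst.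
  by near=> z; rewrite add0r; symmetry; near: z.
have [b [d [p [q [q0 _ _ fpq]]]]] := filter_ex rf.
have qn0 := hornerN0 q0.
have [n [s s0 qE]] := multiplicity_XsubC q a.
move: s0; rewrite qn0 /= => s0.
have [[u v]/= uv] : exists u, u.1 * ('X - a%:P) ^+ n + u.2 * s = 1.
  apply/Bezout_eq1_coprimepP.
  by apply: coprimep_expl; rewrite coprimep_sym coprimep_XsubC.
pose D := ('X - a%:P) ^+ n : {poly F}.
pose t := (p * v) %% D; pose c := p * u + (p * v) %/ D * s.
have pE : p = c * D + t * s.
  rewrite -[LHS]mulr1 -uv mulrDr !mulrA {1}(divp_eq (p * v) D) -/t -/D /c.
  by ring.
have st : (size t <= n)%N.
  have : (size t < size D)%N by rewrite ltn_modp /D expf_neq0 // polyXsubC_eq0.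
  by rewrite size_exp_XsubC ltnS.
rewrite -/D in qE.
have Dz z : D.[z] = (z - a) ^+ n by rewrite horner_exp !hE.
pose w0 w := \sum_(i < n) t`_i * w ^+ (n - i.+1).
exists (fun z => - (t.[z] / D.[z])), (fun w => - (w0 w / (1 - w * a) ^+ n)),
  (fun z => c.[z] / s.[z]); split=> //.
split.
- move=> z za; apply/regular_atN/regular_at_frac.
  by rewrite Dz expf_neq0// subr_eq0.
- move=> w wa; apply: regular_atN; apply: regular_atM.
    apply: regular_at_sum => i _; apply: regular_atM; first exact: regular_at_cst.
    by apply: regular_atX; exact: regular_at_id.
  apply: regular_atV; first by rewrite expf_neq0// subr_eq0 eq_sym.
  apply: regular_atX; apply: regular_atD; first exact: regular_at_cst.
  apply: regular_atN; apply: regular_atM; first exact: regular_at_id.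
  exact: regular_at_cst.
- move=> w wn0; rewrite mulrN; congr (- _); rewrite mulrA Dz.
  have -> : w^-1 - a = (1 - w * a) / w by field.
  rewrite expr_div_n invf_div mulrA; congr (_ / _).
  rewrite (horner_coef_wide _ st) mulr_suml mulr_sumr; apply: eq_bigr => i _.
  rewrite mulrCA -mulrA; congr (_ * _).
  rewrite -exprS subnSK // [RHS]expfB_cond ?(negbTE wn0) ?add0n ?(ltnW (ltn_ord i))//.
  by rewrite exprVn mulrC.
- exact: regular_at_frac.
have sn := cofin_horner (hornerN0 s0).
have an := cofin_neq a.
near=> z.
have -> : f z = p.[z] / q.[z] by near: z.
have sz : s.[z] != 0 by near: z.
have za : z != a by near: z.
have Dz0 : D.[z] != 0 by rewrite Dz expf_neq0// subr_eq0.
clearbody c D; rewrite pE qE !hE.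
by field; rewrite sz Dz0.
Unshelve. all: by end_near.
Qed.

End RationalGerms.

(** * Sections of the structure sheaf *)

Section Opens.
Variable F : closedFieldType.
Implicit Types (U V : set (P1 F)).

Lemma chart1_inj : injective (@chart1 F).
Proof.
move=> w w'; rewrite /chart1; case: (eqVneq w 0) => [->|w0];
  case: (eqVneq w' 0) => [->|w'0] //.
by move=> [/invr_inj].
Qed.

Lemma chart1_neq0 (w : F) : w != 0 -> chart1 w = chart0 w^-1.
Proof. by rewrite /chart1 => /negbTE ->. Qed.

Lemma open_cofinite U x : open U -> U x -> finite_set (~` U).
Proof. by move=> [->|]. Qed.

Lemma cofinite_open U : finite_set (~` U) -> open U.
Proof. by right. Qed.

Lemma open_setD1 U x : open U -> open (U `\ x).
Proof.
move=> oU; rewrite setDE; apply: openI => //; apply: cofinite_open.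
by rewrite setCK; exact: finite_set1.
Qed.

Lemma chart0_cofin U x : open U -> U x -> \forall z \near @cofin F, U (chart0 z).
Proof.
move=> oU Ux; apply: (finite_preimage (f := @chart0 F) (B := ~` U)).
  by move=> a b _ _ [].
exact: open_cofinite Ux.
Qed.

Lemma chart1_cofin U x : open U -> U x -> \forall w \near @cofin F, U (chart1 w).
Proof.
move=> oU Ux; apply: (finite_preimage (f := @chart1 F) (B := ~` U)).
  by move=> a b _ _; exact: chart1_inj.
exact: open_cofinite Ux.
Qed.

End Opens.

Section ExtFunctions.
Variables (F : closedFieldType) (m : nat).
Implicit Types (u v : F -> ext F m) (a : F).

Definition ext_regular u a := forall A, regular_at (fun z => u z A) a.

(** The derivative d/dz with theta held constant. *)
Definition jet u a : ext F m := [ffun A => der (fun z => u z A) a].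

Lemma ext_regular_congr u v a : u a = v a ->
  (\forall z \near @cofin F, u z = v z) -> ext_regular u a -> ext_regular v a.
Proof.
move=> uva uv ru A; apply: regular_at_congr (ru A); first by rewrite uva.
by near=> z; congr (fun_of_fin _ A); near: z.
Unshelve. all: by end_near.
Qed.

Lemma ext_regular_eq u v a : ext_regular u a -> ext_regular v a ->
  (\forall z \near @cofin F, u z = v z) -> u a = v a.
Proof.
move=> ru rv uv; apply/ffunP => A.
apply: (@regular_at_eq F (fun z => u z A) (fun z => v z A)) => //.
by near=> z; congr (fun_of_fin _ A); near: z.
Unshelve. all: by end_near.
Qed.

Lemma jet_congr u v a : u a = v a ->
  (\forall z \near @cofin F, u z = v z) -> jet u a = jet v a.
Proof.
move=> uva uv; apply/ffunP => A; rewrite !ffunE; apply: der_congr.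
  by rewrite uva.
by near=> z; congr (fun_of_fin _ A); near: z.
Unshelve. all: by end_near.
Qed.

Lemma ext_regular_cst (e : ext F m) a : ext_regular (fun=> e) a.
Proof. by move=> A; exact: regular_at_cst. Qed.

Lemma ext_regularD u v a : ext_regular u a -> ext_regular v a ->
  ext_regular (fun z => u z + v z) a.
Proof.
move=> ru rv A; under eq_fun do rewrite ffunE.
by apply: regular_atD; [exact: ru|exact: rv].
Qed.

Lemma ext_regularM u v a : ext_regular u a -> ext_regular v a ->
  ext_regular (fun z => ext_mul (u z) (v z)) a.
Proof.
move=> ru rv A; under eq_fun do rewrite ffunE.
apply: regular_at_sum => B _; apply: regular_atM; first exact: regular_at_cst.
by apply: regular_atM; [exact: ru|exact: rv].
Qed.

Lemma ext_regular_jet u a : (\forall z \near @cofin F, ext_regular u z) ->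
  ext_regular u a -> ext_regular (jet u) a.
Proof.
move=> ru rua A; rewrite /jet.
have -> : (fun z => jet u z A) = der (fun z => u z A).
  by apply/funext => z; rewrite ffunE.
by apply: regular_at_der => //; apply: filterS ru => z rz; exact: rz.
Qed.

Lemma jetP u a A : ext_regular u a -> has_deriv (fun z => u z A) a (jet u a A).
Proof. by move=> ru; rewrite ffunE; exact: derP. Qed.

Lemma jetE u a (e : ext F m) :
  (forall A, has_deriv (fun z => u z A) a (e A)) -> jet u a = e.
Proof. by move=> ue; apply/ffunP => A; rewrite ffunE (derE (ue A)). Qed.

Lemma jet_linear (c : F) u v a : ext_regular u a -> ext_regular v a ->
  jet (fun z => c *: u z + v z) a = c *: jet u a + jet v a.
Proof.
move=> ru rv; apply: jetE => A; under eq_fun do rewrite !ffunE.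
rewrite ffunE [X in X + _]ffunE; apply: has_derivD; last exact: jetP.
by apply: has_derivZ; exact: jetP.
Qed.

Lemma jetM u v a : ext_regular u a -> ext_regular v a ->
  jet (fun z => ext_mul (u z) (v z)) a =
  ext_mul (jet u a) (v a) + ext_mul (u a) (jet v a).
Proof.
move=> ru rv; apply: jetE => A; under eq_fun do rewrite ffunE.
rewrite !ffunE -big_split /=; apply: has_deriv_sum => B _.
by rewrite -mulrDr; apply: has_derivZ; apply: has_derivM; exact: jetP.
Qed.

End ExtFunctions.

Section Sections.
Variables (F : closedFieldType) (m : nat).
Local Notation S := (superfun F m).
Implicit Types (U V W : set (P1 F)) (s t : S).

(** The expression in the phi_A of the element whose coordinates in the theta_A
   are [e], at the point w = 1/z. *)
Definition transition (e : ext F m) (w : F) : ext F m :=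
  [ffun A : {set 'I_m} => w ^- #|A| * e A].

(** A pointwise form of [O_sec]. *)
Record section U s : Prop := {
  section_regular0 : forall z, U (chart0 z) -> ext_regular s.1 z;
  section_regular1 : forall w, U (chart1 w) -> ext_regular s.2 w;
  section_out0 : forall z, ~ U (chart0 z) -> s.1 z = 0;
  section_out1 : forall w, ~ U (chart1 w) -> s.2 w = 0;
  section_transition : forall w, w != 0 -> U (chart1 w) ->
    s.2 w = transition (s.1 w^-1) w }.

Lemma O_secP U s : open U -> O_sec U s <-> section U s.
Proof.
move=> oU.
have r0 A : regular_on (chart0 @^-1` U) (fun z => s.1 z A) <->
    forall z, U (chart0 z) -> regular_at (fun z => s.1 z A) z.
  have [U0|fU] := oU; first by rewrite U0; split=> // _ a.
  apply: regular_onP; apply: (finite_preimage (f := @chart0 F) (B := ~` U)) fU.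
  by move=> a b _ _ [].
have r1 A : regular_on (chart1 @^-1` U) (fun z => s.2 z A) <->
    forall w, U (chart1 w) -> regular_at (fun z => s.2 z A) w.
  have [U0|fU] := oU; first by rewrite U0; split=> // _ a.
  apply: regular_onP; apply: (finite_preimage (f := @chart1 F) (B := ~` U)) fU.
  by move=> a b _ _; exact: chart1_inj.
split=> [[s1 s2 s3 s4 s5]|[s1 s2 s3 s4 s5]]; split=> //.
- by move=> z Uz A; exact: (r0 A).1 (s1 A) z Uz.
- by move=> z Uz A; exact: (r1 A).1 (s2 A) z Uz.
- by move=> w w0 Uw; apply/ffunP => A; rewrite ffunE s5.
- by move=> A; apply/(r0 A) => z Uz; exact: s1.
- by move=> A; apply/(r1 A) => z Uz; exact: s2.
- by move=> w w0 Uw A; rewrite s5// ffunE.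
Qed.

(** The chart at infinity adds at most one point, at which values are determined by
   regularity. *)
Lemma section_eq U s t : open U -> section U s -> section U t ->
  (forall z, U (chart0 z) -> s.1 z = t.1 z) -> s = t.
Proof.
move=> oU ss st e0; rewrite (surjective_pairing s) (surjective_pairing t).
have e1 w : w != 0 -> U (chart1 w) -> s.2 w = t.2 w.
  move=> w0 Uw; rewrite (section_transition ss)// (section_transition st)//.
  by rewrite e0// -chart1_neq0.
congr pair; apply/funext => x.
  have [Ux|Ux] := pselect (U (chart0 x)); first exact: e0.
  by rewrite (section_out0 ss)// (section_out0 st).
have [Ux|Ux] := pselect (U (chart1 x)); last first.
  by rewrite (section_out1 ss)// (section_out1 st).
apply: ext_regular_eq.
- exact: section_regular1 ss _ Ux.
- exact: section_regular1 st _ Ux.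
have n0 := cofin_neq (0 : F); have nU := chart1_cofin oU Ux.
by near=> w; apply: e1; near: w.
Unshelve. all: by end_near.
Qed.

Lemma section_res U (u : S) : open U ->
  (forall z, U (chart0 z) -> ext_regular u.1 z) ->
  (forall w, U (chart1 w) -> ext_regular u.2 w) ->
  (forall w, w != 0 -> U (chart1 w) -> u.2 w = transition (u.1 w^-1) w) ->
  section U (O_res U u).
Proof.
move=> oU r0 r1 tr; split=> /=.
- move=> z Uz; apply: ext_regular_congr (r0 z Uz); first by rewrite asboolT.
  have nU := chart0_cofin oU Uz.
  by near=> y; rewrite asboolT//; near: y.
- move=> z Uz; apply: ext_regular_congr (r1 z Uz); first by rewrite asboolT.
  have nU := chart1_cofin oU Uz.
  by near=> y; rewrite asboolT//; near: y.
- by move=> z Uz; rewrite asboolF.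
- by move=> z Uz; rewrite asboolF.
- move=> w w0 Uw; rewrite asboolT// asboolT; first exact: tr.
  by rewrite -chart1_neq0.
Unshelve. all: by end_near.
Qed.

Lemma section_restrict U V s : open V -> V `<=` U -> section U s ->
  section V (O_res V s).
Proof.
move=> oV VU [s1 s2 _ _ s5]; apply: section_res => //.
- by move=> z /VU; exact: s1.
- by move=> z /VU; exact: s2.
- by move=> w w0 /VU; exact: s5.
Qed.

Lemma transitionM (e f : ext F m) w : w != 0 ->
  ext_mul (transition e w) (transition f w) = transition (ext_mul e f) w.
Proof.
move=> w0; apply/ffunP => A; rewrite !ffunE mulr_sumr; apply: eq_bigr => B BA.
rewrite !ffunE.
have -> : w ^- #|A| = w ^- #|B| * w ^- #|A :\: B|.
  by rewrite -invfM -exprD -{1}(cardsID B A) (finset.setIidPr BA).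
by ring.
Qed.

Lemma section_mul U s t : section U s -> section U t -> section U (O_mul s t).
Proof.
move=> [s1 s2 s3 s4 s5] [t1 t2 t3 t4 t5]; split=> /=.
- by move=> z Uz; apply: ext_regularM; [exact: s1|exact: t1].
- by move=> z Uz; apply: ext_regularM; [exact: s2|exact: t2].
- move=> z Uz; rewrite s3//; apply/ffunP => A; rewrite !ffunE big1// => B _.
  by rewrite ffunE mul0r mulr0.
- move=> z Uz; rewrite s4//; apply/ffunP => A; rewrite !ffunE big1// => B _.
  by rewrite ffunE mul0r mulr0.
- by move=> w w0 Uw; rewrite s5// t5// transitionM.
Qed.

(** Meaningful when [V] does not contain the point at infinity, so that a section
   is a function of z alone. *)
Definition affine_section V (u : F -> ext F m) : S :=
  O_res V (u, fun w => transition (u w^-1) w).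

Lemma section_affine V u : open V -> ~ V None ->
  (forall z, V (chart0 z) -> ext_regular u z) -> section V (affine_section V u).
Proof.
move=> oV Vn ru; apply: section_res => //= w Vw.
have w0 : w != 0.
  by apply: contra_notN Vn => /eqP w0; move: Vw; rewrite w0 /chart1 eqxx.
move=> A; under eq_fun do rewrite ffunE.
apply: regular_atM.
  apply: regular_atV; first by rewrite expf_neq0.
  by apply: regular_atX; exact: regular_at_id.
apply: (regular_at_comp_inv (f := fun z => u z A)) => //.
by apply: ru; rewrite -chart1_neq0.
Qed.

Lemma affine_sectionE V u z : V (chart0 z) -> (affine_section V u).1 z = u z.
Proof. by move=> Vz; rewrite /= asboolT. Qed.

End Sections.

(** * The Grassmann algebra on two generators *)

(** The index of theta_1^a theta_2^b; every identity below is checked on these four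
   coordinates. *)
Definition mono (a b : bool) : {set 'I_2} := [set i | if i == ord0 then a else b].

Lemma monoE (A : {set 'I_2}) : A = mono (ord0 \in A) (ord_max \in A).
Proof.
apply/setP => i; rewrite inE; case: eqP => [->//|/eqP i0].
by congr (_ \in A); apply/val_inj; case: i i0 => -[|[|n]].
Qed.

Lemma in_mono0 a b : (ord0 \in mono a b) = a.
Proof. by rewrite inE eqxx. Qed.

Lemma in_mono1 a b : (ord_max \in mono a b) = b.
Proof. by rewrite inE. Qed.

Lemma card_mono a b : #|mono a b| = (a + b)%N.
Proof.
rewrite cardE /enum_mem -enumT /= enum_ordSl enum_ordSl /=.
have -> : enum 'I_0 = [::] by apply/eqP; rewrite -size_eq0 size_enum_ord.
by rewrite /= !inE /=; case: a; case: b.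
Qed.

Lemma sub_mono a b c d : (mono a b \subset mono c d) = (a ==> c) && (b ==> d).
Proof.
apply/fintype.subsetP/andP => [sub|[/implyP ac /implyP bd] i].
  split; apply/implyP => h.
    by have := sub ord0; rewrite !in_mono0; exact.
  by have := sub ord_max; rewrite !in_mono1; exact.
by rewrite !inE; case: eqP.
Qed.

Lemma mono_diff a b c d : mono a b :\: mono c d = mono (a && ~~ c) (b && ~~ d).
Proof. by apply/setP => i; rewrite !inE; case: eqP => _; rewrite andbC. Qed.

Lemma inversions_mono a b c d : inversions (mono a b) (mono c d) = (b && c).
Proof.
have lt2 (i j : 'I_2) : (j < i)%N = (i == ord_max) && (j == ord0).
  by case: i => -[|[|i]] // ?; case: j => -[|[|j]] // ?.
rewrite /inversions (eq_card (B := fun ij : 'I_2 * 'I_2 =>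
    (b && c) && (ij == (ord_max, ord0)))).
  by case: (b && c); [exact: card1|apply: eq_card0 => ij].
move=> [i j]; rewrite inE /= lt2 [RHS]/(_ && _) xpair_eqE /=.
case: eqVneq => [->|_]; last by rewrite !andbF; case: (b) => //; case: c.
case: eqVneq => [->|_]; last by rewrite !andbF; case: (b) => //; case: c.
by rewrite in_mono0 in_mono1 !andbT; case: (b) => //; case: c.
Qed.

Lemma sum_mono (R : nmodType) (G : {set 'I_2} -> R) (P : pred {set 'I_2}) :
  \sum_(A | P A) G A =
  \sum_(a : bool) \sum_(b : bool) if P (mono a b) then G (mono a b) else 0.
Proof.
rewrite big_mkcond pair_big /= (reindex (fun ab : bool * bool => mono ab.1 ab.2))//=.
exists (fun A : {set 'I_2} => (ord0 \in A, ord_max \in A)) => [[a b] _|A _] /=.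
  by rewrite in_mono0 in_mono1.
by rewrite -monoE.
Qed.

Section Ext2.
Variable F : closedFieldType.
Local Notation E := (ext F 2).
Implicit Types (e f : E).

Lemma ext2P e f : (forall a b, e (mono a b) = f (mono a b)) -> e = f.
Proof. by move=> ef; apply/ffunP => A; rewrite (monoE A). Qed.

Definition mk_ext (c : bool -> bool -> F) : E :=
  [ffun A : {set 'I_2} => c (ord0 \in A) (ord_max \in A)].

Lemma mk_extE c a b : mk_ext c (mono a b) = c a b.
Proof. by rewrite ffunE in_mono0 in_mono1. Qed.

Lemma mul00 e f : ext_mul e f (mono false false) =
  e (mono false false) * f (mono false false).
Proof.
rewrite ffunE sum_mono !big_bool /= !sub_mono /=.
rewrite !mono_diff !inversions_mono /=.
by rewrite !(add0r, addr0, expr0, mul1r).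
Qed.

Lemma mul10 e f : ext_mul e f (mono true false) =
  e (mono false false) * f (mono true false) +
  e (mono true false) * f (mono false false).
Proof.
rewrite ffunE sum_mono !big_bool /= !sub_mono /=.
rewrite !mono_diff !inversions_mono /=.
by rewrite !(add0r, addr0, expr0, mul1r) addrC.
Qed.

Lemma mul01 e f : ext_mul e f (mono false true) =
  e (mono false false) * f (mono false true) +
  e (mono false true) * f (mono false false).
Proof.
rewrite ffunE sum_mono !big_bool /= !sub_mono /=.
rewrite !mono_diff !inversions_mono /=.
by rewrite !(add0r, addr0, expr0, mul1r) addrC.
Qed.

Lemma mul11 e f : ext_mul e f (mono true true) =
  e (mono false false) * f (mono true true) +
  e (mono true true) * f (mono false false) +
  e (mono true false) * f (mono false true) -
  e (mono false true) * f (mono true false).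
Proof.
rewrite ffunE sum_mono !big_bool /= !sub_mono /=.
rewrite !mono_diff !inversions_mono /=.
by rewrite !(expr0, expr1); ring.
Qed.

Lemma transitionE e w a b :
  transition e w (mono a b) = w ^- (a + b) * e (mono a b).
Proof. by rewrite ffunE card_mono. Qed.

Definition mulE := (mul00, mul10, mul01, mul11).

Lemma extD e f A : (e + f) A = e A + f A. Proof. by rewrite ffunE. Qed.
Lemma extN e A : (- e) A = - e A. Proof. by rewrite ffunE. Qed.
Lemma extZ c e A : (c *: e) A = c * e A. Proof. by rewrite ffunE. Qed.
Lemma ext0 A : (0 : E) A = 0. Proof. by rewrite ffunE. Qed.
Definition extE := (extD, extN, extZ, ext0).

Definition ext_homog (p : bool) e := forall A : {set 'I_2}, odd #|A| != p -> e A = 0.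

Lemma homogP p e : ext_homog p e <->
  if p then e (mono false false) = 0 /\ e (mono true true) = 0
  else e (mono true false) = 0 /\ e (mono false true) = 0.
Proof.
split=> [he|]; first by case: p he => he; split; apply: he; rewrite card_mono.
move=> he A; rewrite (monoE A) card_mono.
by case: (ord0 \in A); case: (ord_max \in A); case: p he => -[].
Qed.

(** Left derivative with respect to theta_1 ([false]) or theta_2 ([true]); moving
   theta_2 to the left past theta_1 costs a sign. *)
Definition dtheta (i : bool) e : E :=
  mk_ext (fun a b => if i then (if b then 0 else (-1) ^+ a * e (mono a true))
                    else (if a then 0 else e (mono true b))).

Definition theta (i : bool) : E :=
  mk_ext (fun a b => ((a == ~~ i) && (b == i))%:R).

(** Values of a vector field on the coordinates at one point: [None] stands for z
   and [Some i] for the odd coordinates. *)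
Definition coefs := option bool -> E.
Implicit Types (X : coefs).

(** The value at a point of f du/dz + g_1 du/dtheta_1 + g_2 du/dtheta_2, where [u]
   and [u'] are the values of a function and of its z-derivative. *)
Definition act X (u u' : E) : E :=
  ext_mul (X None) u' + ext_mul (X (Some false)) (dtheta false u) +
  ext_mul (X (Some true)) (dtheta true u).

Definition coefs_homog (p : bool) X := forall j, ext_homog (p (+) isSome j) (X j).

Ltac ext_comp :=
  apply: ext2P => -[] []; rewrite /act ?(extE, mulE, mk_extE, transitionE) /=;
  rewrite ?(extE, mulE, mk_extE, transitionE) /=.

Ltac gen_comp := repeat match goal with
  |- context [?t] => lazymatch t with fun_of_fin _ (mono _ _) =>
    generalize t; intro end
  end.

Lemma act_linear X (c : F) u u' v v' :
  act X (c *: u + v) (c *: u' + v') = c *: act X u u' + act X v v'.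
Proof. ext_comp; rewrite ?expr0 ?expr1; gen_comp; by ring. Qed.

Lemma act_homog p q X u u' : coefs_homog p X -> ext_homog q u ->
  ext_homog q u' -> ext_homog (p (+) q) (act X u u').
Proof.
move=> hX /homogP hu /homogP hu'; apply/homogP.
move: (hX None) (hX (Some false)) (hX (Some true)) => /homogP h0 /homogP h1 /homogP h2.
case: p q hu hu' h0 h1 h2 {hX} => -[] /= [u1 u2] [v1 v2] [x1 x2] [y1 y2] [z1 z2];
  rewrite /act !(extE, mulE, mk_extE) /= ?(u1,u2,v1,v2,x1,x2,y1,y2,z1,z2);
  by split; ring.
Qed.

(** The pointwise super Leibniz rule: the sign appears when the coefficients and the
   odd derivatives are moved past the first factor. *)
Lemma act_leibniz p q X u u' v v' : coefs_homog p X -> ext_homog q u ->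
  ext_homog q u' ->
  act X (ext_mul u v) (ext_mul u' v + ext_mul u v') =
  ext_mul (act X u u') v + (-1) ^+ (p && q) *: ext_mul u (act X v v').
Proof.
move=> hX /homogP hu /homogP hu'.
move: (hX None) (hX (Some false)) (hX (Some true)) => /homogP h0 /homogP h1 /homogP h2.
ext_comp; case: p q hu hu' h0 h1 h2 {hX} => -[] /= [u1 u2] [v1 v2] [x1 x2] [y1 y2] [z1 z2];
  rewrite ?(u1,u2,v1,v2,x1,x2,y1,y2,z1,z2) ?expr0 ?expr1;
  gen_comp; by ring.
Qed.

(** The values of the vector field on w = 1/z and phi_i = theta_i / z, rewritten in
   the chart at infinity. *)
Definition coefs_transition X (w : F) : coefs := fun j =>
  transition (if j is Some i then
      w *: X (Some i) - w ^+ 2 *: ext_mul (X None) (theta i)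
    else - w ^+ 2 *: X None) w.

(** The chain rule. The last argument of [act] on the left is the w-derivative of
   w^(-#|A|) u_A(1/w). *)
Lemma act_transition X (u u' : E) (w : F) : w != 0 ->
  act (coefs_transition X w) (transition u w)
   (mk_ext (fun a b => - (a + b)%:R * w ^- (a + b).+1 * u (mono a b)
                     - w ^- (a + b).+2 * u' (mono a b))) =
  transition (act X u u') w.
Proof.
move=> w0; ext_comp; rewrite ?addn0 ?addn1 ?expr0 ?expr1; rewrite ?invr1; gen_comp; by field; rewrite ?w0.
Qed.

End Ext2.

(** * Derivations at a point *)

Section Derivation.
Variable F : closedFieldType.
Local Notation E := (ext F 2).
Implicit Types (u v : F -> E) (a : F) (V : set F) (p q : bool).

Definition ext_one : E := mk_ext (fun b c => (~~ b && ~~ c)%:R).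

Definition coord (j : option bool) (z : F) : E :=
  if j is Some i then theta F i else z *: ext_one.

Lemma mul1e (e : E) : ext_mul ext_one e = e.
Proof.
by apply: ext2P => -[] []; rewrite ?(mulE, mk_extE) /= ?mulE ?mk_extE /=; ring.
Qed.

Lemma mule1 (e : E) : ext_mul e ext_one = e.
Proof.
by apply: ext2P => -[] []; rewrite ?(mulE, mk_extE) /= ?mulE ?mk_extE /=; ring.
Qed.

Lemma ext_expand (e : E) : e =
  e (mono false false) *: ext_one + (e (mono true false) *: theta F false +
  (e (mono false true) *: theta F true +
   e (mono true true) *: ext_mul (theta F false) (theta F true))).
Proof.
by apply: ext2P => -[] []; rewrite ?(extE, mulE, mk_extE) /=
  ?(extE, mulE, mk_extE) /=; ring.
Qed.

Lemma ext_mulZl (c : F) (e f : E) : ext_mul (c *: e) f = c *: ext_mul e f.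
Proof.
by have := ext_mulDl c e 0 f; rewrite addr0 => ->; rewrite (_ : ext_mul 0 f = 0)
  ?addr0//; apply/ffunP => A; rewrite !ffunE big1// => B _; rewrite ffunE mul0r mulr0.
Qed.

Lemma ext_mul0l (e : E) : ext_mul 0 e = 0.
Proof. by have := ext_mulZl 0 0 e; rewrite !scale0r. Qed.

Lemma ext_mul0r (e : E) : ext_mul e 0 = 0.
Proof.
by have := ext_mulDr (-1) 0 0 e; rewrite scaler0 addr0 scaleN1r addNr.
Qed.

(** A derivation that kills the coordinates kills constants (1 = 1 * 1 and
   theta_1 theta_2 reduce to the coordinates) and z - a; by Hadamard's lemma, at
   [a] nothing else contributes. *)
Lemma derivation_eq0 V a p (delta : (F -> E) -> E) :
  finite_set (~` V) -> V a ->
  (forall c u v, (forall z, V z -> ext_regular u z) ->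
    (forall z, V z -> ext_regular v z) ->
    delta (fun z => c *: u z + v z) = c *: delta u + delta v) ->
  (forall q u v, (forall z, V z -> ext_regular u z) ->
    (forall z, V z -> ext_regular v z) -> (forall z, ext_homog q (u z)) ->
    delta (fun z => ext_mul (u z) (v z)) =
    ext_mul (delta u) (v a) + (-1) ^+ (p && q) *: ext_mul (u a) (delta v)) ->
  (forall j, delta (coord j) = 0) ->
  forall u, (forall z, V z -> ext_regular u z) -> delta u = 0.
Proof.
move=> fV Va lin leib dcoord.
have rcst (e : E) z : V z -> ext_regular (fun=> e) z.
  by move=> _; exact: ext_regular_cst.
have rcoord j z : V z -> ext_regular (coord j) z.
  move=> _; case: j => [i|]; first exact: ext_regular_cst.
  move=> A; rewrite /coord; under eq_fun do rewrite ffunE.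
  by apply: regular_atM; [exact: regular_at_id|exact: regular_at_cst].
have done1 : delta (fun=> ext_one) = 0.
  have hone (z : F) : ext_homog false ext_one.
    by apply/homogP; rewrite !mk_extE.
  have := leib false _ _ (rcst ext_one) (rcst ext_one) hone.
  under [X in delta X]eq_fun do rewrite mul1e.
  rewrite andbF expr0 scale1r mul1e mule1 => /eqP.
  by rewrite -subr_eq0 opprD addrA subrr add0r oppr_eq0 => /eqP.
have dtheta2 : delta (fun=> ext_mul (theta F false) (theta F true)) = 0.
  have hth (z : F) : ext_homog true (theta F false).
    by apply/homogP; rewrite !mk_extE.
  have := leib true _ _ (rcst (theta F false)) (rcst (theta F true)) hth.
  by rewrite !(dcoord (Some _)) => ->; rewrite ext_mul0l ext_mul0r scaler0 addr0.
have dcst (e : E) : delta (fun=> e) = 0.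
  rewrite (ext_expand e).
  rewrite (lin _ _ _ (rcst ext_one) (rcst _)) done1 scaler0 add0r.
  rewrite (lin _ _ _ (rcst (theta F false)) (rcst _)) (dcoord (Some false)) scaler0 add0r.
  rewrite (lin _ _ _ (rcst (theta F true)) (rcst _)) (dcoord (Some true)) scaler0 add0r.
  have := lin (e (mono true true)) _ (fun=> 0)
    (rcst (ext_mul (theta F false) (theta F true))) (rcst 0).
  under [X in delta X]eq_fun do rewrite addr0.
  move=> ->; rewrite dtheta2 scaler0 add0r.
  have := lin (-1) _ _ (rcst 0) (rcst 0).
  under [X in delta X]eq_fun do rewrite scaler0 addr0.
  by rewrite scaleN1r addNr.
pose zeta z : E := (- a) *: ext_one + coord None z.
have rzeta z : V z -> ext_regular zeta z.
  move=> Vz; apply: ext_regularD; [exact: rcst|exact: rcoord].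
have dzeta : delta zeta = 0.
  rewrite (lin (- a) _ _ (rcst ext_one) (rcoord None)).
  by rewrite dcoord done1 scaler0 addr0.
have zetaE z : zeta z = (z - a) *: ext_one.
  by rewrite /zeta /coord -scalerDl addrC.
move=> u ru.
(* u = u(a) + zeta * w, with delta zeta = 0 and zeta(a) = 0 *)
have /choice[g gP] : forall A, exists g : F -> F,
    (forall z, V z -> regular_at g z) /\
    forall z, u z A = u a A + (z - a) * g z.
  move=> A; have [g rg gE] := regular_factor fV Va (fun z Vz => ru z Vz A).
  by exists g.
pose w z : E := [ffun A => g A z].
have rw z : V z -> ext_regular w z.
  by move=> Vz A; rewrite /w; under eq_fun do rewrite ffunE; exact: (gP A).1.
have -> : u = fun z => 1 *: u a + ext_mul (zeta z) (w z).
  apply/funext => z; apply/ffunP => A.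
  by rewrite zetaE ext_mulZl mul1e scale1r !ffunE (gP A).2.
have rzw z : V z -> ext_regular (fun z => ext_mul (zeta z) (w z)) z.
  by move=> Vz; apply: ext_regularM; [exact: rzeta|exact: rw].
have hzeta z : ext_homog false (zeta z).
  by apply/homogP; rewrite zetaE !extE !mk_extE mulr0.
rewrite (lin 1 _ _ (rcst (u a)) rzw) dcst scaler0 add0r.
rewrite (leib false _ _ rzeta rw hzeta).
by rewrite dzeta ext_mul0l zetaE subrr scale0r ext_mul0l scaler0 addr0.
Qed.

Lemma jet_cst (e : E) a : jet (fun=> e) a = 0.
Proof. by apply: jetE => A; rewrite ffunE; exact: has_deriv_cst. Qed.

Lemma jet_scale (f : F -> F) (e : E) a d : has_deriv f a d ->
  jet (fun z => f z *: e) a = d *: e.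
Proof.
move=> fd; apply: jetE => A; under eq_fun do rewrite ffunE.
rewrite ffunE; have := has_derivM fd (has_deriv_cst (e A) a).
by rewrite mulr0 addr0.
Qed.

Lemma act_scale_one (X : coefs F) (c d : F) :
  act X (c *: ext_one) (d *: ext_one) = d *: X None.
Proof.
by apply: ext2P => -[] []; rewrite /act ?(extE, mulE, mk_extE) /=
  ?(extE, mulE, mk_extE) /= ?expr0 ?expr1; ring.
Qed.

Lemma act_scale_theta (X : coefs F) (c d : F) i :
  act X (c *: theta F i) (d *: theta F i) =
  c *: X (Some i) + d *: ext_mul (X None) (theta F i).
Proof.
by case: i; apply: ext2P => -[] []; rewrite /act ?(extE, mulE, mk_extE) /=
  ?(extE, mulE, mk_extE) /= ?expr0 ?expr1; ring.
Qed.

Lemma act_coord (X : coefs F) a j : act X (coord j a) (jet (coord j) a) = X j.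
Proof.
case: j => [i|] /=.
  have := act_scale_theta X 1 0 i.
  by rewrite !scale0r !scale1r addr0 jet_cst.
by rewrite (jet_scale _ (has_deriv_id a)) act_scale_one scale1r.
Qed.

(** The vector field with the same values on coordinates is a derivation too, so
   [derivation_eq0] applies to the difference. *)
Lemma derivation_act V a p (X : coefs F) (delta : (F -> E) -> E) :
  finite_set (~` V) -> V a -> coefs_homog p X ->
  (forall c u v, (forall z, V z -> ext_regular u z) ->
    (forall z, V z -> ext_regular v z) ->
    delta (fun z => c *: u z + v z) = c *: delta u + delta v) ->
  (forall q u v, (forall z, V z -> ext_regular u z) ->
    (forall z, V z -> ext_regular v z) -> (forall z, ext_homog q (u z)) ->
    delta (fun z => ext_mul (u z) (v z)) =
    ext_mul (delta u) (v a) + (-1) ^+ (p && q) *: ext_mul (u a) (delta v)) ->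
  (forall j, delta (coord j) = X j) ->
  forall u, (forall z, V z -> ext_regular u z) -> delta u = act X (u a) (jet u a).
Proof.
move=> fV Va hX lin leib dcoord u ru; apply/eqP; rewrite -subr_eq0; apply/eqP.
apply: (@derivation_eq0 V a p (fun u => delta u - act X (u a) (jet u a))) ru => //.
- move=> c v w rv rw; rewrite lin// jet_linear; [|exact: rv|exact: rw].
  by rewrite act_linear scalerBr opprD addrACA.
- move=> q v w rv rw hv; rewrite (leib q)// jetM; [|exact: rv|exact: rw].
  have hv' : ext_homog q (jet v a).
    move=> A Aq; rewrite ffunE.
    under eq_fun do rewrite (hv _ A Aq).
    exact: derE (has_deriv_cst 0 a).
  rewrite (act_leibniz _ _ hX (hv a) hv').
  have mulBl (x y z : E) : ext_mul (x - y) z = ext_mul x z - ext_mul y z.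
    by rewrite -scaleN1r addrC ext_mulDl scaleN1r addrC.
  have mulBr (x y z : E) : ext_mul z (x - y) = ext_mul z x - ext_mul z y.
    by rewrite -scaleN1r addrC ext_mulDr scaleN1r addrC.
  by rewrite mulBl mulBr scalerBr opprD addrACA.
by move=> j; rewrite dcoord act_coord subrr.
Qed.

End Derivation.

(** * Vector fields as superderivations *)

Section VectorFields.
Variable F : closedFieldType.
Local Notation E := (ext F 2).
Local Notation S := (superfun F 2).
Implicit Types (U V W : set (P1 F)) (s t : S) (X Y : F -> coefs F) (p q : bool).

(** [X] and [Y] are the coefficients in the charts (z|theta) and (w|phi). *)
Definition vfield U X Y : set (P1 F) -> S -> S := fun V s =>
  if `[< [/\ open V, V `<=` U & O_sec V s] >] then
    O_res V (fun z => act (X z) (s.1 z) (jet s.1 z),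
             fun w => act (Y w) (s.2 w) (jet s.2 w))
  else 0.

Record is_vfield p U X Y : Prop := {
  vfield_regular0 : forall z, U (chart0 z) -> forall j, ext_regular (X^~ j) z;
  vfield_regular1 : forall w, U (chart1 w) -> forall j, ext_regular (Y^~ j) w;
  vfield_homog0 : forall z, U (chart0 z) -> coefs_homog p (X z);
  vfield_transition : forall w, w != 0 -> U (chart1 w) ->
    Y w = coefs_transition (X w^-1) w }.

Lemma coefs_transition_homog p (x : coefs F) w :
  coefs_homog p x -> coefs_homog p (coefs_transition x w).
Proof.
move=> hx j; move: (hx None) (hx j) => /homogP h0 /homogP hj; apply/homogP.
by case: j hj => [[]|]; case: p h0 {hx} => -[] x0 x1 /= [y0 y1];
  rewrite !transitionE !(extE, mulE, mk_extE) /= ?mk_extE ?(x0, x1, y0, y1);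
  split; ring.
Qed.

(** Parity passes to the chart at infinity by the change of coordinates, and to
   w = 0 by regularity. *)
Lemma vfield_homog1 p U X Y : open U -> is_vfield p U X Y ->
  forall w, U (chart1 w) -> coefs_homog p (Y w).
Proof.
move=> oU XY w Uw j A Aj.
apply: (@regular_at_eq F (fun w => Y w j A) (fun=> 0)).
- exact: (vfield_regular1 XY Uw j A).
- exact: regular_at_cst.
have nU := chart1_cofin oU Uw; have n0 := cofin_neq (0 : F).
near=> y.
have y0 : y != 0 by near: y.
have Uy : U (chart1 y) by near: y.
rewrite (vfield_transition XY)//; apply: coefs_transition_homog Aj.
by apply: (vfield_homog0 XY); rewrite -chart1_neq0.
Unshelve. all: by end_near.
Qed.

Lemma jet_transition U s w : open U -> section U s -> w != 0 -> U (chart1 w) ->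
  jet s.2 w = mk_ext (fun a b =>
     - (a + b)%:R * w ^- (a + b).+1 * s.1 w^-1 (mono a b)
     - w ^- (a + b).+2 * jet s.1 w^-1 (mono a b)).
Proof.
move=> oU ss w0 Uw.
have -> : jet s.2 w = jet (fun w => transition (s.1 w^-1) w) w.
  apply: jet_congr; first exact: section_transition ss _ w0 Uw.
  have nU := chart1_cofin oU Uw; have n0 := cofin_neq (0 : F).
  by near=> y; apply: (section_transition ss); near: y.
apply: jetE => A; rewrite (monoE A) mk_extE.
move: (ord0 \in A) (ord_max \in A) => a b.
have rs : ext_regular s.1 w^-1.
  by apply: (section_regular0 ss); rewrite -chart1_neq0.
have ds := has_deriv_comp_inv w0 (jetP (mono a b) rs).
have dw : has_deriv (fun w : F => w ^+ (a + b)) w ((a + b)%:R * w ^+ (a + b).-1).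
  have := has_deriv_poly 'X^(a + b) w.
  rewrite derivXn hornerMn hornerXn mulr_natl.
  by have -> : horner ('X^(a + b) : {poly F}) = (fun w => w ^+ (a + b)) by
    apply/funext => y; rewrite hornerXn.
have wab : w ^+ (a + b) != 0 by rewrite expf_neq0.
have := has_derivM (has_derivV (f := fun w => w ^+ (a + b)) wab dw) ds.
under [X in has_deriv X _ _ -> _]eq_fun do rewrite -transitionE.
suff -> : - ((a + b)%:R * w ^+ (a + b).-1) / w ^+ (a + b) ^+ 2 *
   s.1 w^-1 (mono a b) + w ^- (a + b) * (- jet s.1 w^-1 (mono a b) / w ^+ 2) =
  - (a + b)%:R * w ^- (a + b).+1 * s.1 w^-1 (mono a b) -
  w ^- (a + b).+2 * jet s.1 w^-1 (mono a b) by [].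
move: (s.1 w^-1 (mono a b)) (jet s.1 w^-1 (mono a b)) => x y.
by case: (a) (b) => -[]; rewrite ?addn0 ?addn1 /= ?expr0 ?expr1n ?invr1; field => //.
Unshelve. all: by end_near.
Qed.

Lemma vfield_section p U V X Y s : is_vfield p U X Y ->
  open V -> V `<=` U -> section V s ->
  section V (O_res V (fun z => act (X z) (s.1 z) (jet s.1 z),
             fun w => act (Y w) (s.2 w) (jet s.2 w))).
Proof.
move=> XY oV VU ss.
have rd i (u : F -> E) z : ext_regular u z -> ext_regular (fun z => dtheta i (u z)) z.
  move=> ru A; under eq_fun do rewrite ffunE.
  move: i (ord0 \in A) (ord_max \in A) => [] [] []; try exact: regular_at_cst;
    try exact: ru; by apply: regular_atM; [exact: regular_at_cst|exact: ru].
have ract (Z : F -> coefs F) (u : F -> E) z :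
    (forall j, ext_regular (Z^~ j) z) -> ext_regular u z ->
    (\forall z \near @cofin F, ext_regular u z) ->
    ext_regular (fun z => act (Z z) (u z) (jet u z)) z.
  move=> rZ ru run; rewrite /act.
  apply: ext_regularD; first apply: ext_regularD; apply: ext_regularM;
    by [exact: rZ|exact: rd|exact: ext_regular_jet].
apply: section_res => //=.
- move=> z Vz; apply: ract.
  + exact: (vfield_regular0 XY (VU _ Vz)).
  + exact: section_regular0 ss _ Vz.
  + by apply: filterS (chart0_cofin oV Vz); exact: section_regular0 ss.
- move=> z Vz; apply: ract.
  + exact: (vfield_regular1 XY (VU _ Vz)).
  + exact: section_regular1 ss _ Vz.
  + by apply: filterS (chart1_cofin oV Vz); exact: section_regular1 ss.
move=> w w0 Vw; rewrite (jet_transition oV ss w0 Vw).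
rewrite (section_transition ss w0 Vw) (vfield_transition XY w0 (VU _ Vw)).
exact: act_transition.
Qed.

Lemma O_homogP q s : O_homog q s <->
  forall x, ext_homog q (s.1 x) /\ ext_homog q (s.2 x).
Proof.
split=> [h x|h x A Aq]; first by split=> A Aq; have [] := h x A Aq.
by have [h1 h2] := h x; split; [exact: h1|exact: h2].
Qed.

Lemma jet_homog q (u : F -> E) a : (forall z, ext_homog q (u z)) -> ext_homog q (jet u a).
Proof.
move=> hu A Aq; rewrite ffunE; under eq_fun do rewrite (hu _ A Aq).
exact: derE (has_deriv_cst 0 a).
Qed.

Lemma ext_homog0 q : ext_homog q (0 : E).
Proof. by move=> A _; rewrite ffunE. Qed.

Lemma vfield_superderivation p U X Y : open U -> is_vfield p U X Y -> T_sec p U (vfield U X Y).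
Proof.
move=> oU XY; have XYh1 := vfield_homog1 oU XY; split.
- by move=> V s nV; rewrite /vfield asboolF.
- move=> V W s oV VU oW WV sV; have ss := (O_secP s oV).1 sV.
  have sW := section_restrict oW WV ss.
  have WU := subset_trans WV VU.
  rewrite /vfield asboolT; last by split=> //; apply/(O_secP _ oW).
  rewrite asboolT//; congr pair; apply/funext => x; case: asboolP => // Wx.
    rewrite [in RHS]/= asboolT; last exact: WV.
    have e1 : (O_res W s).1 x = s.1 x by rewrite /= asboolT.
    congr act; [exact: e1|apply: jet_congr; first exact: e1].
    by near=> y; rewrite /= asboolT//; near: y; exact: chart0_cofin oW Wx.
  rewrite [in RHS]/= asboolT; last exact: WV.
  have e1 : (O_res W s).2 x = s.2 x by rewrite /= asboolT.
  congr act; [exact: e1|apply: jet_congr; first exact: e1].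
  by near=> y; rewrite /= asboolT//; near: y; exact: chart1_cofin oW Wx.
move=> V oV VU.
have vE s : O_sec V s -> vfield U X Y V s =
    O_res V (fun z => act (X z) (s.1 z) (jet s.1 z),
             fun w => act (Y w) (s.2 w) (jet s.2 w)).
  by move=> sV; rewrite /vfield asboolT.
split.
- move=> s sV; rewrite vE//; apply/O_secP => //.
  exact: (vfield_section XY oV VU ((O_secP s oV).1 sV)).
- move=> a s t sV tV; rewrite !vE//; last exact: O_sec_linear.
  have [ss tt] := ((O_secP s oV).1 sV, (O_secP t oV).1 tV).
  rewrite -O_res_linear; congr pair; apply/funext => x /=; case: asboolP => // Vx.
    rewrite jet_linear ?act_linear//; last exact: section_regular0 tt _ Vx.
    exact: section_regular0 ss _ Vx.
  rewrite jet_linear ?act_linear//; last exact: section_regular1 tt _ Vx.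
  exact: section_regular1 ss _ Vx.
- move=> q s sV /O_homogP hs; rewrite vE//; apply/O_homogP => x.
  split=> /=; case: asboolP => Vx; try exact: ext_homog0; apply: act_homog.
  + exact: (vfield_homog0 XY (VU _ Vx)).
  + by have [] := hs x.
  + by apply: jet_homog => z; have [] := hs z.
  + exact: XYh1 (VU _ Vx).
  + by have [] := hs x.
  + by apply: jet_homog => z; have [] := hs z.
move=> q s t sV tV /O_homogP hs.
have [ss tt] := ((O_secP s oV).1 sV, (O_secP t oV).1 tV).
rewrite !vE//; last by apply/(O_secP _ oV); exact: section_mul.
congr pair; apply/funext => x /=; rewrite !fctE; case: asboolP => // Vx.
- rewrite jetM; [|exact: section_regular0 ss _ Vx|exact: section_regular0 tt _ Vx].
  apply: act_leibniz.
  + exact: (vfield_homog0 XY (VU _ Vx)).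
  + by have [] := hs x.
  + by apply: jet_homog => z; have [] := hs z.
- by rewrite (section_out0 ss Vx) (section_out0 tt Vx) !ext_mul0l scaler0 addr0.
- rewrite jetM; [|exact: section_regular1 ss _ Vx|exact: section_regular1 tt _ Vx].
  apply: act_leibniz.
  + exact: XYh1 (VU _ Vx).
  + by have [] := hs x.
  + by apply: jet_homog => z; have [] := hs z.
- by rewrite (section_out1 ss Vx) (section_out1 tt Vx) !ext_mul0l scaler0 addr0.
Unshelve. all: by end_near.
Qed.

End VectorFields.

(** * Superderivations are vector fields *)

Section Classification.
Variable F : closedFieldType.
Local Notation E := (ext F 2).
Local Notation S := (superfun F 2).
Implicit Types (U V W : set (P1 F)) (s t : S) (X Y : F -> coefs F) (p q : bool).
Implicit Types (D : set (P1 F) -> S -> S).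

Lemma coord_regular j z : ext_regular (@coord F j) z.
Proof.
case: j => [i|]; first exact: ext_regular_cst.
move=> A; rewrite /coord; under eq_fun do rewrite ffunE.
by apply: regular_atM; [exact: regular_at_id|exact: regular_at_cst].
Qed.

Lemma theta_homog i : ext_homog true (theta F i).
Proof. by apply/homogP; rewrite !mk_extE; case: i. Qed.

Lemma one_homog (c : F) : ext_homog false (c *: ext_one F).
Proof. by apply/homogP; rewrite !extE !mk_extE /= mulr0. Qed.

Lemma coord_homog j z : ext_homog (isSome j) (@coord F j z).
Proof. by case: j => [i|]; [exact: theta_homog|exact: one_homog]. Qed.

Lemma transition_homog q (e : E) w : ext_homog q e -> ext_homog q (transition e w).
Proof. by move=> he A Aq; rewrite ffunE he// mulr0. Qed.

Lemma affine_section_homog V q (u : F -> E) : (forall z, ext_homog q (u z)) ->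
  O_homog q (affine_section V u).
Proof.
move=> hu; apply/O_homogP => x; split=> /=; case: asboolP => _ //;
  try exact: ext_homog0; exact: transition_homog.
Qed.

Lemma affine_section_linear V c (u v : F -> E) :
  affine_section V (fun z => c *: u z + v z) = c *: affine_section V u + affine_section V v.
Proof.
rewrite /affine_section -O_res_linear; congr (O_res V _); congr pair.
apply/funext => w; apply/ffunP => A; rewrite /= !fctE !ffunE mulrDr.
by congr (_ + _); exact: mulrCA.
Qed.

Lemma affine_section_mul V (u v : F -> E) : open V -> ~ V None ->
  (forall z, V (chart0 z) -> ext_regular u z) ->
  (forall z, V (chart0 z) -> ext_regular v z) ->
  affine_section V (fun z => ext_mul (u z) (v z)) = O_mul (affine_section V u) (affine_section V v).
Proof.
move=> oV Vn ru rv; apply: (section_eq oV).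
- by apply: section_affine => // z Vz; apply: ext_regularM; [exact: ru|exact: rv].
- by apply: section_mul; exact: section_affine.
by move=> z Vz; rewrite affine_sectionE// [RHS]/= asboolT.
Qed.

(** Restriction to the affine chart does not change values, and over an affine
   open set a superderivation followed by evaluation at [a] is a derivation at
   [a]. *)
Lemma derivation_value p U D V s a : open U -> T_sec p U D ->
  open V -> V `<=` U -> section V s -> V (chart0 a) ->
  (D V s).1 a = act (fun j => (D (U `\ None) (affine_section (U `\ None) (coord j))).1 a)
                    (s.1 a) (jet s.1 a).
Proof.
move=> oU [D1 D2 D3] oV VU ss Va.
pose Uz := U `\ None; pose V' := V `\ None.
have oUz : open Uz by exact: open_setD1.
have oV' : open V' by exact: open_setD1.
have V'n : ~ V' None by move=> [_]; exact.
have Uzn : ~ Uz None by move=> [_]; exact.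
have V'V : V' `<=` V by move=> x [].
have V'U : V' `<=` U by exact: subset_trans VU.
have UzU : Uz `<=` U by move=> x [].
have V'Uz : V' `<=` Uz by move=> x [Vx xn]; split=> //; exact: VU.
have V'a : V' (chart0 a) by [].
have ru z : V' (chart0 z) -> ext_regular s.1 z.
  by move=> /V'V Vz; exact: (section_regular0 ss Vz).
have lsec u : (forall z, V' (chart0 z) -> ext_regular u z) -> O_sec V' (affine_section V' u).
  by move=> hu; apply/(O_secP _ oV'); exact: section_affine.
have sE : O_res V' s = affine_section V' s.1.
  apply: (section_eq oV'); first exact: section_restrict V'V ss.
    exact: section_affine.
  by move=> z V'z; rewrite affine_sectionE//= asboolT.
have sV : O_sec V s by apply/(O_secP _ oV).
have -> : (D V s).1 a = (D V' (affine_section V' s.1)).1 a.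
  by rewrite -sE (D2 V)// /O_res /= asboolT.
have [C1 C2 C3 C4] := D3 V' oV' V'U.
(* The values on the coordinates over [V'] are restricted from [U] minus
   infinity, so they do not depend on [V]. *)
have coordD j : D V' (affine_section V' (coord j)) = O_res V' (D Uz (affine_section Uz (coord j))).
  have lz : section Uz (affine_section Uz (@coord F j)).
    by apply: section_affine => // z _; exact: coord_regular.
  rewrite -(D2 Uz)//; last by apply/(O_secP _ oUz).
  congr (D V' _); apply: (section_eq oV').
  - by apply: section_affine => // z _; exact: coord_regular.
  - exact: section_restrict V'Uz lz.
  - move=> z V'z; rewrite affine_sectionE//= !asboolT//; exact: V'Uz.
have fV : finite_set (~` (chart0 @^-1` V')) by exact: chart0_cofin V'a.
apply: (derivation_act (V := chart0 @^-1` V') (p := p)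
  (delta := fun u => (D V' (affine_section V' u)).1 a)) ru => //.
- move=> j.
  have [_ _ Cz _] := D3 Uz oUz UzU.
  have lz : O_sec Uz (affine_section Uz (@coord F j)).
    by apply/(O_secP _ oUz); apply: section_affine => // z _; exact: coord_regular.
  have hz := @affine_section_homog Uz _ _ (@coord_homog j).
  by have /O_homogP/(_ a)[] := Cz _ _ lz hz.
- by move=> c u v ru rv; rewrite affine_section_linear C2//; exact: lsec.
- move=> q u v ru rv hu; rewrite affine_section_mul// (C4 q)//.
  + by rewrite [LHS]/= !fctE /= !asboolT.
  + exact: lsec.
  + exact: lsec.
  + exact: affine_section_homog.
- by move=> j; rewrite coordD /O_res /= asboolT.
Qed.

Definition coord_inf (j : option bool) : S :=
  (fun z => z^-1 *: (if j is Some i then theta F i else ext_one F), coord j).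

Lemma section_coord_inf U j : open U ->
  section (U `\ chart0 0) (O_res (U `\ chart0 0) (coord_inf j)).
Proof.
move=> oU; apply: section_res => /=.
- exact: open_setD1.
- move=> z [_ z0] A; under eq_fun do rewrite ffunE.
  apply: regular_atM (regular_at_cst _ _).
  apply: (regular_atV (f := id)) (regular_at_id z).
  by apply: contra_not_neq z0 => /= ->.
- by move=> w _; exact: coord_regular.
move=> w w0 _; rewrite invrK.
case: j => [[]|]; apply: ext2P => -[] [];
  rewrite ?(transitionE, extE, mk_extE) /= ?addn0 ?addn1 ?mk_extE /= ?expr0 ?invr1;
  by field => //.

Qed.

Lemma coord_inf_value (x : coefs F) j w : w != 0 ->
  transition (act x ((coord_inf j).1 w^-1) (jet (coord_inf j).1 w^-1)) w =
  coefs_transition x w j.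
Proof.
move=> w0; have dV := has_derivV (f := id) (invr_neq0 w0) (has_deriv_id w^-1).
rewrite /coefs_transition; congr transition.
rewrite /= (jet_scale _ dV) invrK.
have -> : - 1 / w^-1 ^+ 2 = - w ^+ 2 by rewrite exprVn invrK mulN1r.
case: j => [i|]; last exact: act_scale_one.
by rewrite act_scale_theta scaleNr.
Qed.

(** The coefficients at infinity are the values on w and phi_i; they are regular
   because a superderivation maps sections to sections. *)
Lemma superderivation_vfield p U D : open U -> T_sec p U D ->
  exists X Y, is_vfield p U X Y /\ D = vfield U X Y.
Proof.
move=> oU TD; have [D1 D2 D3] := TD.
pose Uz := U `\ None; pose Uw := U `\ chart0 0.
have oUz : open Uz by exact: open_setD1.
have oUw : open Uw by exact: open_setD1.
have UzU : Uz `<=` U by move=> x [].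
have UwU : Uw `<=` U by move=> x [].
have Uzn : ~ Uz None by move=> [_]; exact.
pose X z j := (D Uz (affine_section Uz (coord j))).1 z.
pose Y w j := (D Uw (O_res Uw (coord_inf j))).2 w.
have zsec j : O_sec Uz (affine_section Uz (@coord F j)).
  by apply/(O_secP _ oUz); apply: section_affine => // z _; exact: coord_regular.
have wsec j : O_sec Uw (O_res Uw (coord_inf j)).
  by apply/(O_secP _ oUw); exact: section_coord_inf.
have [Dz _ Hz _] := D3 Uz oUz UzU.
have [Dw _ _ _] := D3 Uw oUw UwU.
have in_Uw w : U (chart1 w) -> Uw (chart1 w).
  move=> Uw'; split=> // /=; rewrite /chart1; case: eqVneq => // w0 [] /eqP.
  by rewrite invr_eq0 (negbTE w0).
have XY : is_vfield p U X Y.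
  split.
  - move=> z Uz' j; have /(O_secP _ oUz) sz := Dz _ (zsec j).
    by apply: (section_regular0 sz); split.
  - move=> w Uw' j; have /(O_secP _ oUw) sw := Dw _ (wsec j).
    by apply: (section_regular1 sw); exact: in_Uw.
  - move=> z _ j; have hz := @affine_section_homog Uz _ _ (@coord_homog j).
    by have /O_homogP/(_ z)[] := Hz _ _ (zsec j) hz.
  - move=> w w0 Uw'; apply/funext => j.
    have /(O_secP _ oUw) sw := Dw _ (wsec j).
    rewrite /Y (section_transition sw w0 (in_Uw _ Uw')).
    have Uwv : Uw (chart0 w^-1) by rewrite -chart1_neq0//; exact: in_Uw.
    have /(O_secP _ oUw) cw := wsec j.
    rewrite (derivation_value oU TD oUw UwU cw Uwv) -coord_inf_value//.
    have cE : (O_res Uw (coord_inf j)).1 w^-1 = (coord_inf j).1 w^-1.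
      by rewrite /= asboolT.
    rewrite cE; congr (transition (act _ _ _) _); apply: jet_congr => //.
    by near=> y; rewrite /= asboolT//; near: y; exact: chart0_cofin oUw Uwv.
exists X, Y; split=> //; apply/funext => V; apply/funext => s.
have [[oV VU sV]|nV] := pselect [/\ open V, V `<=` U & O_sec V s]; last first.
  by rewrite D1// /vfield asboolF.
rewrite /vfield asboolT//.
have ss := (O_secP _ oV).1 sV.
have [DV _ _ _] := D3 V oV VU.
apply: (section_eq oV).
- by apply/(O_secP _ oV); exact: DV.
- exact: (vfield_section XY oV VU ss).
by move=> z Vz; rewrite (derivation_value oU TD oV VU ss Vz) /= asboolT.
Unshelve. all: by end_near.
Qed.

Lemma vfield_eq p U X Y X' Y' : open U -> is_vfield p U X Y ->
  is_vfield p U X' Y' -> (forall z, U (chart0 z) -> X z = X' z) ->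
  vfield U X Y = vfield U X' Y'.
Proof.
move=> oU XY XY' XX'; apply/funext => V; apply/funext => s; rewrite /vfield.
case: asboolP => // -[oV VU sV]; have ss := (O_secP _ oV).1 sV.
apply: (section_eq oV).
- exact: (vfield_section XY oV VU ss).
- exact: (vfield_section XY' oV VU ss).
by move=> z Vz; rewrite /= !asboolT// XX'//; exact: VU.
Qed.

Lemma vfield_inj p U X Y X' Y' : open U -> is_vfield p U X Y ->
  is_vfield p U X' Y' -> vfield U X Y = vfield U X' Y' ->
  forall z, U (chart0 z) -> X z = X' z.
Proof.
move=> oU XY XY' e z Uz.
pose V := U `\ None.
have oV : open V by exact: open_setD1.
have VU : V `<=` U by move=> x [].
have Vz : V (chart0 z) by [].
have sV j : O_sec V (affine_section V (@coord F j)).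
  apply/(O_secP _ oV); apply: section_affine => // [[_]|y _]; first exact.
  exact: coord_regular.
have val Z Z' j : is_vfield p U Z Z' ->
    (vfield U Z Z' V (affine_section V (coord j))).1 z = Z z j.
  move=> ZZ'; rewrite /vfield asboolT// /O_res /= asboolT//.
  rewrite -[RHS](act_coord (Z z) z j); congr act.
  apply: jet_congr; first by rewrite asboolT.
  by near=> y; rewrite asboolT//; near: y; exact: chart0_cofin oV Vz.
by apply/funext => j; rewrite -(val X Y)// e val.
Unshelve. all: by end_near.
Qed.

Lemma act_linear_coefs (c : F) (x y : coefs F) u u' :
  act (c *: x + y) u u' = c *: act x u u' + act y u u'.
Proof.
rewrite /act !fctE !ext_mulDl !scalerDr.
by rewrite [X in X + _ = _]addrACA [LHS]addrACA.
Qed.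

Lemma vfield_linear U (c : F) X Y X' Y' :
  vfield U (c *: X + X') (c *: Y + Y') = c *: vfield U X Y + vfield U X' Y'.
Proof.
apply/funext => V; apply/funext => s; rewrite !fctE /vfield.
case: asboolP => _; last by rewrite scaler0 addr0.
by rewrite -O_res_linear; congr (O_res V _); congr pair; apply/funext => x;
  rewrite !fctE act_linear_coefs.
Qed.

Lemma vfield_res p U V X Y : open V -> V `<=` U ->
  is_vfield p U X Y -> T_res V (vfield U X Y) = vfield V X Y.
Proof.
move=> oV VU XY; apply/funext => W; apply/funext => s; rewrite /T_res /vfield.
case: asboolP => WV; last by rewrite asboolF// => -[].
congr (if _ then _ else _); apply/asboolP/asboolP => -[oW _ sW]; split=> //.
exact: subset_trans VU.
Qed.

Lemma is_vfieldS p U V X Y : V `<=` U -> is_vfield p U X Y -> is_vfield p V X Y.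
Proof.
move=> VU [h1 h2 h3 h4]; split.
- by move=> z /VU; exact: h1.
- by move=> z /VU; exact: h2.
- by move=> z /VU; exact: h3.
- by move=> w w0 /VU; exact: h4.
Qed.

End Classification.

(** * Principal parts of vector fields *)

Section FirstCohomology.
Variable F : closedFieldType.
Local Notation E := (ext F 2).
Local Notation S := (superfun F 2).
Implicit Types (U V W : set (P1 F)) (s t : S) (X Y : F -> coefs F) (p q : bool).
Implicit Types (D : set (P1 F) -> S -> S).

Lemma ext_regularZ (f : F -> F) (u : F -> E) z : regular_at f z ->
  ext_regular u z -> ext_regular (fun z => f z *: u z) z.
Proof.
move=> rf ru A; under eq_fun do rewrite ffunE.
by apply: regular_atM => //; exact: ru.
Qed.

Lemma ext_regular_transition (u : F -> E) w : w != 0 -> ext_regular u w ->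
  ext_regular (fun w => transition (u w) w) w.
Proof.
move=> w0 ru A; under eq_fun do rewrite ffunE.
apply: regular_atM; last exact: ru.
apply: regular_atV; first by rewrite expf_neq0.
by apply: regular_atX; exact: regular_at_id.
Qed.

Lemma ext_regular_comp_inv (u : F -> E) w : w != 0 -> ext_regular u w^-1 ->
  ext_regular (fun w => u w^-1) w.
Proof. by move=> w0 ru A; exact: (regular_at_comp_inv w0 (ru A)). Qed.

(** Over an affine open set the coefficients in the chart at infinity are given by
   the change of coordinates, since w never vanishes there. *)
Lemma is_vfield_affine p U X : ~ U None ->
  (forall z, U (chart0 z) -> forall j, ext_regular (X^~ j) z) ->
  (forall z, U (chart0 z) -> coefs_homog p (X z)) ->
  is_vfield p U X (fun w => coefs_transition (X w^-1) w).
Proof.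
move=> Un rX hX; split=> // w Uw j.
have w0 : w != 0.
  by apply: contra_notN Un => /eqP w0; move: Uw; rewrite w0 /chart1 eqxx.
have rXj i : ext_regular (fun w => X w^-1 i) w.
  by apply: (ext_regular_comp_inv (u := X^~ i)) => //; apply: rX; rewrite -chart1_neq0.
have rid := regular_at_id w.
rewrite /coefs_transition; apply: ext_regular_transition => //.
case: j => [i|].
  apply: ext_regularD; first exact: ext_regularZ.
  under eq_fun do rewrite -scaleNr.
  apply: ext_regularZ; first by apply/regular_atN/regular_atX.
  by apply: ext_regularM => //; exact: ext_regular_cst.
by apply: ext_regularZ => //; apply/regular_atN/regular_atX.
Qed.

(** [K] has minus the principal parts of [D] at [a]. Its coefficients at z = 1/w are
   [w] times regular functions, and this factor turns the exponents -#|A| + 1 and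
   -#|A| + 2 of the change of coordinates into 2 - #|A| and 3 - #|A|, which are
   nonnegative as #|A| is at most 2. *)
Lemma mittag_leffler p U a D : open U -> ~ U None -> U (chart0 a) ->
  T_sec p (U `\ chart0 a) D ->
  exists K L, [/\ T_sec p (~` [set chart0 a]) K, T_sec p U L &
    T_res (U `\ chart0 a) L = T_res (U `\ chart0 a) K + D].
Proof.
move=> oU Un Ua TD; pose V := U `\ chart0 a.
have oV : open V by exact: open_setD1.
have [X [Y [XY DE]]] := superderivation_vfield oV TD.
have nV : \forall z \near @cofin F, V (chart0 z).
  have nU := chart0_cofin oU Ua; have na := cofin_neq a.
  near=> z; split; first by near: z.
  have za : z != a by near: z.
  by move=> [] /eqP; rewrite (negbTE za).
have VU : V `<=` U by move=> x [].
have Va z : U (chart0 z) -> z != a -> V (chart0 z).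
  by move=> Uz za; split=> // -[] /eqP; rewrite (negbTE za).
have /choice[kre H] : forall jA : option bool * {set 'I_2},
    exists kre : (F -> F) * (F -> F) * (F -> F),
    let: (k, r, e) := kre in
    [/\ forall z, z != a -> regular_at k z,
      forall w, w * a != 1 -> regular_at r w,
      forall w, w != 0 -> k w^-1 = w * r w,
      regular_at e a &
      \forall z \near @cofin F, e z = k z + X z jA.1 jA.2] /\
    ((\forall z \near @cofin F, X z jA.1 jA.2 = 0) ->
      k =1 (fun=> 0) /\ r =1 (fun=> 0)).
  move=> [j A] /=.
  have rX : \forall z \near @cofin F, regular_at (fun z => X z j A) z.
    by near=> z; apply: (vfield_regular0 XY) j A; near: z.
  by have [k [r [e kre]]] := principal_part a rX; exists (k, r, e).
pose k j A := (kre (j, A)).1.1; pose r j A := (kre (j, A)).1.2.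
pose e j A := (kre (j, A)).2.
have kP j A : [/\ forall z, z != a -> regular_at (k j A) z,
      forall w, w * a != 1 -> regular_at (r j A) w,
      forall w, w != 0 -> k j A w^-1 = w * r j A w,
      regular_at (e j A) a &
      \forall z \near @cofin F, e j A z = k j A z + X z j A] /\
    ((\forall z \near @cofin F, X z j A = 0) ->
      k j A =1 (fun=> 0) /\ r j A =1 (fun=> 0)).
  by have := H (j, A); rewrite /k /r /e; case: (kre _) => -[].
pose kX z j : E := [ffun A => k j A z].
pose R w j : E := [ffun A => r j A w].
pose kY w j : E := [ffun A : {set 'I_2} => if j is Some i then
   w ^+ (2 - #|A|) * R w j A - w ^+ (3 - #|A|) * ext_mul (R w None) (theta F i) A
   else - (w ^+ (3 - #|A|) * R w j A)].
have card2 (A : {set 'I_2}) : (#|A| <= 2)%N by rewrite (leq_trans (max_card _)) ?card_ord.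
have kXr z j : z != a -> ext_regular (kX^~ j) z.
  move=> za A; rewrite /kX; under eq_fun do rewrite ffunE.
  by have [[rk _ _ _ _] _] := kP j A; exact: rk.
have kXh z : coefs_homog p (kX z).
  move=> j A Aj; rewrite ffunE; have [_ X0] := kP j A.
  suff /X0[-> _] : \forall y \near @cofin F, X y j A = 0 by [].
  by near=> y; apply: (vfield_homog0 XY) Aj; near: y.
have Kvf : is_vfield p (~` [set chart0 a]) kX kY.
  split.
  - by move=> z /= za j; apply: kXr; apply: contra_notN za => /eqP ->.
  - move=> w /= wa j.
    have wa1 : w * a != 1.
      apply: contra_notN wa => /eqP wa1.
      have w0 : w != 0 by apply: contra_eqN wa1 => /eqP ->; rewrite mul0r eq_sym oner_eq0.
      by rewrite chart1_neq0// -[w^-1]mulr1 -wa1 mulKf.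
    have rR i : ext_regular (R^~ i) w.
      move=> A; rewrite /R; under eq_fun do rewrite ffunE.
      by have [[_ rr _ _ _] _] := kP i A; exact: rr.
    have rid := regular_at_id w.
    move=> A; rewrite /kY; under eq_fun do rewrite ffunE.
    case: j => [i|].
      apply: regular_atD.
        by apply: regular_atM; [exact: regular_atX|exact: rR].
      apply: regular_atN; apply: regular_atM; first exact: regular_atX.
      apply: (ext_regularM (u := R^~ None) (v := fun=> theta F i)) => //.
      exact: ext_regular_cst.
    by apply: regular_atN; apply: regular_atM; [exact: regular_atX|exact: rR].
  - by move=> z _; exact: kXh.
  move=> w w0 _; apply/funext => j; apply/ffunP => A.
  have kR i : kX w^-1 i = w *: R w i.
    apply/ffunP => B; rewrite !ffunE; have [[_ _ kr _ _] _] := kP i B.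
    exact: kr.
  rewrite /coefs_transition [in RHS]ffunE [LHS]ffunE.
  have w2 : w ^+ (2 - #|A|) = w ^+ 2 / w ^+ #|A|.
    by rewrite expfB_cond ?(negbTE w0)// add0n.
  have w3 : w ^+ (3 - #|A|) = w ^+ 3 / w ^+ #|A|.
    by rewrite expfB_cond ?(negbTE w0)// add0n ltnW// ltnS.
  have wA : w ^+ #|A| != 0 by rewrite expf_neq0.
  case: j => [i|]; rewrite !kR w3 ?w2 ?ext_mulZl !extE.
    by field.
  by field.
(* The regular part, extended over [a] by its value there. *)
pose eX z : coefs F := if z == a then fun j => [ffun A => e j A a]
  else kX z + X z.
have eXr z : U (chart0 z) -> forall j, ext_regular (eX^~ j) z.
  move=> Uz j A; case: (eqVneq z a) => [->|za].
    have [[_ _ _ re en] _] := kP j A.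
    apply: regular_at_congr re; first by rewrite /eX eqxx ffunE.
    have na := cofin_neq a.
    near=> y; have ya : y != a by near: y.
    rewrite /eX (negbTE ya) fctE !ffunE.
    by near: y.
  apply: regular_at_congr (_ : regular_at (fun z => kX z j A + X z j A) z).
  - by rewrite /eX (negbTE za) fctE extD.
  - have na := cofin_neq a; near=> y.
    have ya : y != a by near: y.
    by rewrite /eX (negbTE ya) fctE extD.
  apply: regular_atD; first exact: kXr.
  exact: (vfield_regular0 XY (Va _ Uz za)).
have eXh z : U (chart0 z) -> coefs_homog p (eX z).
  move=> Uz j A Aj.
  apply: (@regular_at_eq F (fun z => eX z j A) (fun=> 0)).
  - exact: eXr.
  - exact: regular_at_cst.
  have na := cofin_neq a; near=> y.
  have ya : y != a by near: y.
  have Vy : V (chart0 y) by near: y.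
  by rewrite /eX (negbTE ya) fctE extD kXh// (vfield_homog0 XY Vy)// addr0.
have Lvf := is_vfield_affine Un eXr eXh.
set Z := fun w => _ in Lvf.
have VK : V `<=` ~` [set chart0 a] by move=> x [].
have oK : open (~` [set chart0 a]).
  by apply: cofinite_open; rewrite setCK; exact: finite_set1.
exists (vfield (~` [set chart0 a]) kX kY), (vfield U eX Z).
split; [exact: vfield_superderivation|exact: vfield_superderivation|].
rewrite (vfield_res oV VU Lvf) (vfield_res oV VK Kvf) DE.
have := vfield_linear V 1 kX kY X Y; rewrite !scale1r => <-.
have KXY : is_vfield p V (kX + X) (kY + Y).
  have [k1 k2 k3 k4] := is_vfieldS VK Kvf; have [x1 x2 x3 x4] := XY; split.
  - by move=> z Vz j; apply: ext_regularD; [exact: k1|exact: x1].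
  - by move=> z Vz j; apply: ext_regularD; [exact: k2|exact: x2].
  - by move=> z Vz j A Aj; rewrite !fctE extD k3// x3// addr0.
  - move=> w w0 Vw; apply/funext => j; rewrite !fctE k4// x4//.
    apply/ffunP => A; rewrite /coefs_transition.
    have tA (x : E) : transition x w A = w ^- #|A| * x A by rewrite ffunE.
    have mulD (x y z : E) : ext_mul (x + y) z = ext_mul x z + ext_mul y z.
      by have := ext_mulDl 1 x y z; rewrite !scale1r.
    by case: j => [i|]; rewrite extD !tA !extE ?mulD ?extE; ring.
apply: (vfield_eq oV (is_vfieldS VU Lvf) KXY) => z [_ za].
by rewrite /eX ifF//; apply/negbTE; apply: contra_notN za => /eqP ->.
Unshelve. all: by end_near.
Qed.

End FirstCohomology.

(** * Vanishing of the first cohomology *)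

Section Vanishing.
Variables (F : closedFieldType) (P : presheaf F (P1 F)).
Local Notation E := (ambient P).
Implicit Types (U V : set (P1 F)) (s t : E).

Lemma resD V s t : res V (s + t) = res V s + res V t.
Proof. by have := res_linear V 1 s t; rewrite !scale1r. Qed.

Lemma res0 V : res V (0 : E) = 0.
Proof. by apply: (addrI (res V (0 : E))); rewrite -resD !addr0. Qed.

Lemma resB V s t : res V (s - t) = res V s - res V t.
Proof. by rewrite addrC -scaleN1r res_linear scaleN1r addrC. Qed.

Lemma res_sum (I : Type) (r : seq I) (Q : pred I) (G : I -> E) V :
  res V (\sum_(i <- r | Q i) G i) = \sum_(i <- r | Q i) res V (G i).
Proof. exact: (big_morph (@res _ _ P V) (resD V) (res0 V)). Qed.

Lemma secD U s t : open U -> sec U s -> sec U t -> sec U (s + t).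
Proof.
by move=> oU ss st; have := (sec_linear P oU).2 1 s t ss st; rewrite scale1r.
Qed.

Lemma sec_sum (I : eqType) (r : seq I) (Q : pred I) (G : I -> E) U : open U ->
  (forall i, i \in r -> Q i -> sec U (G i)) ->
  sec U (\sum_(i <- r | Q i) G i).
Proof.
move=> oU; elim: r => [|i r IH] hG.
  by rewrite big_nil; exact: (sec_linear P oU).1.
have hr : sec U (\sum_(j <- r | Q j) G j).
  by apply: IH => j jr; apply: hG; rewrite inE jr orbT.
rewrite big_cons; case: ifP => // Qi; apply: secD => //.
by apply: hG; rewrite // mem_head.
Qed.

(** The refinement V_x of W_x adds to W_oo, the open set attached to infinity, at
   most the point x. Hence V_x and V_y meet inside W_oo for x <> y. There all
   f(oo, x) are defined and f(x, y) = f(oo, y) - f(oo, x), so it is enough to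
   extend k + f(oo, x) from W_oo to each of the finitely many points x outside
   of it, for one section [k] over W_oo; [k] is a sum of one term for each such
   point, regular at all the others. *)
Lemma mittag_leffler_H1 : (forall U a s, open U -> ~ U None -> U (chart0 a) ->
  sec (U `\ chart0 a) s ->
  exists k l : E, [/\ sec (~` [set chart0 a]) k, sec U l &
    res (U `\ chart0 a) l = res (U `\ chart0 a) k + s]) ->
  H1_dim P 0.
Proof.
move=> mittag_leffler.
exists (fun=> setT), (fun _ _ _ => 0); split.
- by move=> x; split=> //; exact: openT.
- by case.
- by move=> a _ [].
move=> W f Wc [fT coc]; exists (fun=> 0); rewrite big_ord0.
have oW x : open (W x) by have [] := Wc x.
have Wx x : W x x by have [] := Wc x.
have f0 x : f x x = 0.
  have := coc x x x; rewrite /= subrr add0r !setIid.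
  by have := fT x x; rewrite setIid => fxx; rewrite (res_id (oW x) fxx).
have cocV V x y z : V `<=` W x `&` W y `&` W z ->
    res V (f y z) = res V (f x z) - res V (f x y).
  move=> VW; have := congr1 (res V) (coc x y z).
  rewrite /= res0 resD resB !res_res// => /eqP.
  by rewrite addrAC subr_eq0 => /eqP <-; rewrite addrK.
have [l lE] : exists l : seq (P1 F), ~` W None = [set` l].
  by apply/finite_seqP; exact: open_cofinite (oW None) (Wx None).
have lP x : x \in l <-> ~ W None x.
  by rewrite (_ : (x \in l) = [set` l] x :> Prop)// -lE.
pose V (x : P1 F) := if x is Some _ then (W x `&` (W None `|` [set x])) `\ None
  else W None.
have oV x : open (V x).
  case: x => [a|]; last exact: oW.
  apply: open_setD1; apply: openI => //; apply: cofinite_open.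
  rewrite setCU; apply: finite_setIl.
  exact: open_cofinite (oW None) (Wx None).
have VW x : V x `<=` W x by case: x => [a|//] y [[]].
have Vx x : V x x.
  case: x => [a|]; last exact: Wx.
  by split=> //; split; [exact: Wx|right].
have VWl x y : V x y -> W None y \/ y = x.
  by case: x => [a|]; [move=> [[_ [|->]]]; [left|right]|left].
have VlW x : x \in l -> V x `&` W None = V x `\ x.
  move=> /lP xl; apply/seteqP; split=> y [Vy]; last first.
    by move=> yx; split=> //; have [//|yx'] := VWl _ _ Vy.
  by move=> Wy; split=> // yx; apply: xl; rewrite -yx.
have VnW x : x \notin l -> V x `<=` W None.
  move=> /negP xl y /VWl[//|->]; apply: contrapT => /lP; exact: xl.
have /choice[KL KLP] : forall x, exists KL : E * E, x \in l ->
    [/\ sec (~` [set x]) KL.1, sec (V x) KL.2 &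
      res (V x `\ x) KL.2 = res (V x `\ x) KL.1 + res (V x `\ x) (f None x)].
  move=> x; have [xl|xl] := boolP (x \in l); last by exists (0, 0).
  case: x xl => [a|] xl; last by have /lP[] := xl; exact: Wx.
  have TD : sec (V (Some a) `\ chart0 a)
      (res (V (Some a) `\ chart0 a) (f None (Some a))).
    apply: (res_sec (openI (oW None) (oW (Some a))) (open_setD1 _ (oV (Some a)))
      _ (fT None (Some a))).
    by rewrite -(VlW (Some a) xl) => y [Vy Wy]; split=> //; exact: VW Vy.
  have [|K [L [TK TL KLE]]] :=
      mittag_leffler _ _ _ (oV (Some a)) _ (Vx (Some a)) TD.
    by move=> [_]; exact.
  by exists (K, L).
pose K x := (KL x).1; pose L x := (KL x).2.
pose lu := undup l.
have luE x : (x \in lu) = (x \in l) by exact: mem_undup.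
pose k := \sum_(y <- lu) K y.
(* Outside W_oo, [L x] extends [K x] + f(oo, x), and the other terms of [k] are
   regular at [x]. *)
pose g x := if x \in l then L x + \sum_(y <- lu | y != x) res (V x) (K y)
  else res (V x) (k + f None x).
have TK x y : y \in l -> V x `<=` ~` [set y] -> sec (V x) (res (V x) (K y)).
  move=> /KLP[TKy _ _] Vy; apply: (res_sec _ (oV x) Vy TKy).
  by apply: cofinite_open; rewrite setCK; exact: finite_set1.
have gT x : sec (V x) (g x).
  rewrite /g; case: ifPn => xl.
    apply: (secD (oV x)); first by have [] := KLP x xl.
    apply: (sec_sum (oV x)) => y; rewrite luE => yl yx; apply: TK => // z Vz zy.
    case: (VWl _ _ Vz) => [|zx]; last by rewrite -zx zy eqxx in yx.
    by rewrite zy; exact: (lP y).1.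
  rewrite resD /k res_sum; apply: (secD (oV x)).
    apply: (sec_sum (oV x)) => y; rewrite luE => yl _; apply: TK => // z /(VnW x xl) Wz zy.
    by move: Wz; rewrite zy; exact: (lP y).1.
  apply: (res_sec (openI (oW None) (oW x)) (oV x) _ (fT None x)) => y Vy.
  by split; [exact: VnW Vy|exact: VW].
(* On the common part with W_oo both cases are k + f(oo, x). *)
have gE x : res (V x `&` W None) (g x) = res (V x `&` W None) (k + f None x).
  rewrite /g; case: ifPn => xl; last by rewrite res_res// => y [].
  have [_ _ LE] := KLP x xl.
  rewrite VlW// !resD LE -/(K x) addrAC; congr (_ + _).
  rewrite /k (bigD1_seq x)/= ?luE ?undup_uniq// resD; congr (_ + _).
  rewrite !res_sum; apply: eq_bigr => y _.
  by rewrite res_res// => z [].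
exists V; split.
- by move=> x; split; [exact: oV|exact: Vx].
- exact: VW.
- by move=> x y _.
exists g; first exact: gT.
move=> x y; rewrite -[LHS]/(res (V x `&` V y) (f x y) - res (V x `&` V y) 0)
  res0 subr0.
case: (eqVneq x y) => [<-|xy]; first by rewrite f0 res0 subrr.
have VV : V x `&` V y `<=` W None.
  move=> z [/VWl[//|zx] /VWl[//|zy]].
  by move: xy; rewrite -zx zy eqxx.
rewrite -[res _ (g y)]/(res _ (g y)) -[res _ (g x)]/(res _ (g x)).
have resg z : V x `&` V y `<=` V z -> res (V x `&` V y) (g z) =
    res (V x `&` V y) (k + f None z).
  move=> Vz; have sub : V x `&` V y `<=` V z `&` W None.
    by move=> t Vt; split; [exact: Vz|exact: VV].
  by rewrite -(res_res (g z) sub) gE res_res.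
rewrite !resg; [|by move=> t []..].
rewrite !resD opprD addrACA subrr add0r.
apply: cocV => t Vt; split; last by apply: VW; case: Vt.
by split; [exact: VV|apply: VW; case: Vt].
Qed.

End Vanishing.

(** * Global vector fields *)

Section GlobalFields.
Variable F : closedFieldType.
Local Notation E := (ext F 2).
Implicit Types (X Y : F -> coefs F) (p : bool).

Definition unit_vector (n : nat) (i k : 'I_n) : F := (k == i)%:R.

(** Linearity is required of the coefficients in both charts, but only those in the
   affine chart matter for injectivity and surjectivity, since they determine a
   vector field. *)
Lemma H0_dim_parametrized p n (PX PY : ('I_n -> F) -> F -> coefs F) :
  (forall a, is_vfield p setT (PX a) (PY a)) ->
  (forall (c : F) a b, PX (fun i => c * a i + b i) = c *: PX a + PX b) ->
  (forall (c : F) a b, PY (fun i => c * a i + b i) = c *: PY a + PY b) ->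
  (forall a, (forall z, PX a z = 0) -> forall i, a i = 0) ->
  (forall X Y, is_vfield p setT X Y -> exists a, X = PX a) ->
  H0_dim (tangent F 2 p) n.
Proof.
move=> vf linX linY inj surj.
pose Psi a := vfield setT (PX a) (PY a).
have lin (c : F) a b : Psi (fun i => c * a i + b i) = c *: Psi a + Psi b.
  by rewrite /Psi linX linY vfield_linear.
have Psi0 : Psi (fun=> 0) = 0.
  have := lin (-1) (fun=> 0) (fun=> 0).
  under [X in Psi X]eq_fun do rewrite mulr0 addr0.
  by rewrite scaleN1r addNr.
have sumE (a : 'I_n -> F) : \sum_(i < n) a i *: Psi (unit_vector i) = Psi a.
  have -> : Psi a = Psi (fun k => \sum_(i < n) a i * unit_vector i k).
    congr Psi; apply/funext => k; rewrite (bigD1 k)//= /unit_vector eqxx mulr1.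
    by rewrite big1 ?addr0// => i ik; rewrite eq_sym (negbTE ik) mulr0.
  elim: (index_enum _) => [|i r IH].
    by rewrite big_nil; under [X in Psi X]eq_fun do rewrite big_nil.
  rewrite big_cons IH -lin; congr Psi; apply/funext => k.
  by rewrite big_cons.
have oT : open (setT : set (P1 F)) by exact: openT.
have v0 : is_vfield p setT (0 : F -> coefs F) (0 : F -> coefs F).
  split=> [z _ j|z _ j|z _ j A _|w w0 _].
  - exact: ext_regular_cst.
  - exact: ext_regular_cst.
  - by rewrite ffunE.
  apply/funext => j; apply/ffunP => A; rewrite /coefs_transition [in RHS]ffunE.
  have z0 (z : F) i : (0 : F -> coefs F) z i = 0 by [].
  by case: j => [i|]; rewrite !z0 ?ext_mul0l !extE ?(mulr0, subrr).
exists (fun i => Psi (unit_vector i)); split.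
- by move=> i; exact: vfield_superderivation.
- move=> a /= a0; apply: inj => z.
  apply: (vfield_inj oT (vf a) v0); last by [].
  rewrite -[LHS]sumE a0.
  by have := vfield_linear setT (-1) 0 0 (0 : F -> coefs F) (0 : F -> coefs F);
    rewrite scaler0 addr0 scaleN1r addNr.
move=> D /(superderivation_vfield oT)[X [Y [XY ->]]].
have [a Xa] := surj X Y XY; exists a; rewrite [RHS]sumE.
by apply: (vfield_eq oT XY (vf a)) => z _; rewrite Xa.
Qed.

Lemma global_coefs p X Y : is_vfield p setT X Y ->
  exists P : option bool -> {set 'I_2} -> {poly F}, forall z j A, X z j A = (P j A).[z].
Proof.
move=> XY.
have /choice[P PE] : forall jA : option bool * {set 'I_2},
    exists q : {poly F}, forall z, X z jA.1 jA.2 = q.[z].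
  move=> [j A] /=; apply: regular_everywhere => z.
  exact: (vfield_regular0 XY (I : setT (chart0 z)) j A).
by exists (fun j A => P (j, A)) => z j A; exact: (PE (j, A)).
Qed.

Lemma size_growth_eq (q : {poly F}) k h : regular_at h 0 ->
  (forall w, w != 0 -> h w = w ^+ k * q.[w^-1]) -> (size q <= k.+1)%N.
Proof.
move=> rh hE; apply: size_growth rh _.
by have n0 := cofin_neq (0 : F); near=> w; apply: hE; near: w.
Unshelve. all: by end_near.
Qed.

Lemma horner_size1 (q : {poly F}) z : (size q <= 1)%N -> q.[z] = q`_0.
Proof. by move=> /size1_polyC {1}->; rewrite hornerC. Qed.

Lemma horner_size2 (q : {poly F}) z : (size q <= 2)%N -> q.[z] = q`_0 + q`_1 * z.
Proof.
move=> sq; rewrite (horner_coef_wide _ sq) !big_ord_recl big_ord0 /=.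
by rewrite expr0 mulr1 addr0 expr1.
Qed.

Lemma horner_size3 (q : {poly F}) z :
  (size q <= 3)%N -> q.[z] = q`_0 + q`_1 * z + q`_2 * z ^+ 2.
Proof.
move=> sq; rewrite (horner_coef_wide _ sq) !big_ord_recl big_ord0 /=.
by rewrite expr0 mulr1 addr0 expr1 addrA.
Qed.

Local Notation "a `[ k ]" := (a (@inord 7 k)) (at level 2, format "a `[ k ]").

(** The components f_0 = a_0 + a_1 z + a_2 z^2, f_12 = a_3, and the matrix of the
   linear parts of g_1, g_2, which is constant up to a_2 z on the diagonal: the
   quadratic term of f_0 creates a pole of w g_i(1/w) - w^2 f(1/w) theta_i at
   infinity, which a_2 z cancels. *)
Definition evenX (a : 'I_8 -> F) (z : F) : coefs F := fun j =>
  match j with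
  | None => mk_ext (fun b c => if b (+) c then 0 else
      if b then a`[3] else a`[0] + a`[1] * z + a`[2] * z ^+ 2)
  | Some false => mk_ext (fun b c => if b (+) c then
      if b then a`[4] + a`[2] * z else a`[5] else 0)
  | Some true => mk_ext (fun b c => if b (+) c then
      if b then a`[6] else a`[7] + a`[2] * z else 0)
  end.

Definition evenY (a : 'I_8 -> F) (w : F) : coefs F := fun j =>
  match j with
  | None => mk_ext (fun b c => if b (+) c then 0 else
      if b then - a`[3] else - (a`[0] * w ^+ 2 + a`[1] * w + a`[2]))
  | Some false => mk_ext (fun b c => if b (+) c then
      if b then a`[4] - a`[0] * w - a`[1] else a`[5] else 0)
  | Some true => mk_ext (fun b c => if b (+) c then
      if b then a`[6] else a`[7] - a`[0] * w - a`[1] else 0)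
  end.

(** The four affine functions are f_1, f_2, g_(1,0) and g_(2,0). The theta_1 theta_2
   components of g_1 and g_2 cancel the poles that f theta_i creates at
   infinity. *)
Definition oddX (a : 'I_8 -> F) (z : F) : coefs F := fun j =>
  match j with
  | None => mk_ext (fun b c => if b (+) c then
      if b then a`[0] + a`[1] * z else a`[2] + a`[3] * z else 0)
  | Some false => mk_ext (fun b c => if b (+) c then 0 else
      if b then - a`[3] else a`[4] + a`[5] * z)
  | Some true => mk_ext (fun b c => if b (+) c then 0 else
      if b then a`[1] else a`[6] + a`[7] * z)
  end.

Definition oddY (a : 'I_8 -> F) (w : F) : coefs F := fun j =>
  match j with
  | None => mk_ext (fun b c => if b (+) c then
      if b then - (a`[0] * w + a`[1]) else - (a`[2] * w + a`[3]) else 0)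
  | Some false => mk_ext (fun b c => if b (+) c then 0 else
      if b then a`[2] else a`[4] * w + a`[5])
  | Some true => mk_ext (fun b c => if b (+) c then 0 else
      if b then - a`[0] else a`[6] * w + a`[7])
  end.

Lemma mk_ext_regular (c : F -> bool -> bool -> F) z :
  (forall a b, regular_at (fun z => c z a b) z) ->
  ext_regular (fun z => mk_ext (c z)) z.
Proof. by move=> rc A; under eq_fun do rewrite ffunE; exact: rc. Qed.

Ltac regular := repeat first [ exact: regular_at_cst | exact: regular_at_id
  | apply: regular_atD | apply: regular_atN | apply: regular_atX | apply: regular_atM ].

Lemma even_vfield a : is_vfield false setT (evenX a) (evenY a).
Proof.
split.
- move=> z _; case=> [[]|] /=; apply: mk_ext_regular => -[] [] /=; regular.
- move=> z _; case=> [[]|] /=; apply: mk_ext_regular => -[] [] /=; regular.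
- by move=> z _; case=> [[]|]; apply/homogP; rewrite !mk_extE.
move=> w w0 _; apply/funext => -[[]|]; apply: ext2P => -[] [];
rewrite /coefs_transition !(transitionE, extE, mulE, mk_extE) /=
   ?(transitionE, extE, mulE, mk_extE) /= ?addn0 ?addn1 ?expr0 ?invr1;
  by field => //.
Qed.

Lemma odd_vfield a : is_vfield true setT (oddX a) (oddY a).
Proof.
split.
- move=> z _; case=> [[]|] /=; apply: mk_ext_regular => -[] [] /=; regular.
- move=> z _; case=> [[]|] /=; apply: mk_ext_regular => -[] [] /=; regular.
- by move=> z _; case=> [[]|]; apply/homogP; rewrite !mk_extE.
move=> w w0 _; apply/funext => -[[]|]; apply: ext2P => -[] [];
rewrite /coefs_transition !(transitionE, extE, mulE, mk_extE) /=
   ?(transitionE, extE, mulE, mk_extE) /= ?addn0 ?addn1 ?expr0 ?invr1;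
  by field => //.
Qed.


Lemma params_eq0 (a : 'I_8 -> F) : (forall k, (k < 8)%N -> a`[k] = 0) ->
  forall i, a i = 0.
Proof. by move=> a0 i; rewrite -(inord_val i); exact: a0. Qed.

Lemma even_linear (c : F) a b :
  (evenX (fun i => c * a i + b i) = c *: evenX a + evenX b) /\
  (evenY (fun i => c * a i + b i) = c *: evenY a + evenY b).
Proof.
by split; apply/funext => z; apply/funext => -[[]|]; apply: ext2P => -[] [];
  rewrite !fctE !extE /= !mk_extE /=; ring.
Qed.

Lemma odd_linear (c : F) a b :
  (oddX (fun i => c * a i + b i) = c *: oddX a + oddX b) /\
  (oddY (fun i => c * a i + b i) = c *: oddY a + oddY b).
Proof.
by split; apply/funext => z; apply/funext => -[[]|]; apply: ext2P => -[] [];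
  rewrite !fctE !extE /= !mk_extE /=; ring.
Qed.

Lemma even_inj a : (forall z, evenX a z = 0) -> forall i, a i = 0.
Proof.
move=> a0; apply: params_eq0.
have val z j b c : evenX a z j (mono b c) = 0 by rewrite a0 ffunE.
have a0E := val 0 None false false; have a1E := val 1 None false false.
have a3E := val 0 None true true.
have b0E := val 0 (Some false) true false; have b1E := val 1 (Some false) true false.
have a5E := val 0 (Some false) false true.
have a6E := val 0 (Some true) true false; have a7E := val 0 (Some true) false true.
rewrite /= !mk_extE /= ?expr0n ?expr1n ?mulr0 ?mulr1 ?addr0
  in a0E a1E a3E b0E b1E a5E a6E a7E.
rewrite b0E add0r in b1E; rewrite a0E b1E add0r addr0 in a1E.
by do 8 (case=> //).
Qed.

Lemma odd_inj a : (forall z, oddX a z = 0) -> forall i, a i = 0.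
Proof.
move=> a0; apply: params_eq0.
have val z j b c : oddX a z j (mono b c) = 0 by rewrite a0 ffunE.
have a0E := val 0 None true false; have a1E := val 1 None true false.
have a2E := val 0 None false true; have a3E := val 1 None false true.
have a4E := val 0 (Some false) false false; have a5E := val 1 (Some false) false false.
have a6E := val 0 (Some true) false false; have a7E := val 1 (Some true) false false.
rewrite /= !mk_extE /= ?mulr0 ?mulr1 ?addr0
  in a0E a1E a2E a3E a4E a5E a6E a7E.
rewrite a0E add0r in a1E; rewrite a2E add0r in a3E.
rewrite a4E add0r in a5E; rewrite a6E add0r in a7E.
by do 8 (case=> //).
Qed.

Lemma params_exist (x0 x1 x2 x3 x4 x5 x6 x7 : F) : exists a : 'I_8 -> F,
  [/\ [/\ a`[0] = x0, a`[1] = x1, a`[2] = x2 & a`[3] = x3] &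
      [/\ a`[4] = x4, a`[5] = x5, a`[6] = x6 & a`[7] = x7]].
Proof.
exists (fun i => nth 0 [:: x0; x1; x2; x3; x4; x5; x6; x7] i).
by rewrite !inordK.
Qed.

(** Each bound is [size_growth] for a coefficient in the chart at infinity, corrected
   by the contribution of f_0 on the diagonal. *)
Lemma even_surj X Y : is_vfield false setT X Y -> exists a, X = evenX a.
Proof.
move=> XY; have [P XP] := global_coefs XY.
have hX z j b c : b (+) c = ~~ isSome j -> X z j (mono b c) = 0.
  move=> bc; apply: (@vfield_homog0 _ _ _ _ _ XY z I j (mono b c)).
  by rewrite card_mono oddD !oddb bc; case: (isSome j).
have rY j A : regular_at (fun w => Y w j A) 0.
  exact: (vfield_regular1 XY (I : setT (chart1 0)) j A).
have trY w j A : w != 0 -> Y w j A = coefs_transition (X w^-1) w j A.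
  by move=> w0; rewrite (vfield_transition XY w0).
pose f0 := P None (mono false false); pose f3 := P None (mono true true).
pose g i b c := P (Some i) (mono b c).
have sf0 : (size f0 <= 3)%N.
  apply: size_growth_eq (regular_atN (rY None (mono false false))) _ => w w0.
  rewrite trY// /coefs_transition transitionE extE XP /= expr0 invr1.
  by rewrite -/f0; ring.
have f0E w : w != 0 -> w * f0.[w^-1] = f0`_0 * w + f0`_1 + f0`_2 / w.
  by move=> w0; rewrite (horner_size3 _ sf0); field.
have sf3 : (size f3 <= 1)%N.
  apply: size_growth_eq (regular_atN (rY None (mono true true))) _ => w w0.
  rewrite trY// /coefs_transition transitionE extE XP /= -/f3.
  by field.
have diag i : (size (g i (~~ i) i - f0`_2 *: 'X)%R <= 1)%N.
  apply: (size_growth_eq (h := fun w => Y w (Some i) (mono (~~ i) i)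
     + (f0`_0 * w + f0`_1))).
    apply: regular_atD; first exact: rY.
    by regular.
  move=> w w0; rewrite trY// /coefs_transition transitionE.
  rewrite hornerD hornerN hornerZ hornerX expr0 mul1r.
  have -> : f0`_0 * w + f0`_1 = w * f0.[w^-1] - f0`_2 / w.
    by rewrite f0E// addrK.
  by case: i; rewrite !extE ?mulE !mk_extE !XP /= ?addn0 -/f0 /g; field.
have offdiag i : (size (g i i (~~ i)) <= 1)%N.
  apply: size_growth_eq (rY (Some i) (mono i (~~ i))) _ => w w0.
  rewrite trY// /coefs_transition transitionE.
  by case: i; rewrite !extE ?mulE !mk_extE !XP /= ?addn0 /g; field.
have diagE i z : (g i (~~ i) i).[z] = (g i (~~ i) i)`_0 + f0`_2 * z.
  have := horner_size1 z (diag i).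
  rewrite hornerD hornerN hornerZ hornerX coefB coefZ coefX mulr0 subr0 => <-.
  by rewrite subrK.
have [a [[a0 a1 a2 a3] [a4 a5 a6 a7]]] := params_exist f0`_0 f0`_1 f0`_2 f3`_0
  (g false true false)`_0 (g false false true)`_0
  (g true true false)`_0 (g true false true)`_0.
exists a; apply/funext => z; apply/funext => -[[]|]; apply: ext2P => -[] [];
  rewrite mk_extE /=; try (by apply: hX);
  rewrite XP ?(a0, a1, a2, a3, a4, a5, a6, a7).
- exact: horner_size1 (offdiag true).
- exact: diagE true z.
- exact: diagE false z.
- exact: horner_size1 (offdiag false).
- exact: horner_size1.
- exact: horner_size3.
Qed.

(** For the theta_1 theta_2 components of g_1 and g_2, w times the coefficient at
   infinity vanishes at w = 0 and equals Q(1/w) up to a multiple of w, for a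
   polynomial Q; hence Q = 0. *)
Lemma odd_surj X Y : is_vfield true setT X Y -> exists a, X = oddX a.
Proof.
move=> XY; have [P XP] := global_coefs XY.
have hX z j b c : b (+) c = isSome j -> X z j (mono b c) = 0.
  move=> bc; apply: (@vfield_homog0 _ _ _ _ _ XY z I j (mono b c)).
  by rewrite card_mono oddD !oddb bc; case: (isSome j).
have rY j A : regular_at (fun w => Y w j A) 0.
  exact: (vfield_regular1 XY (I : setT (chart1 0)) j A).
have trY w j A : w != 0 -> Y w j A = coefs_transition (X w^-1) w j A.
  by move=> w0; rewrite (vfield_transition XY w0).
pose f i := P None (mono (~~ i) i).
pose c i := P (Some i) (mono false false); pose d i := P (Some i) (mono true true).
have sf i : (size (f i) <= 2)%N.
  apply: size_growth_eq (regular_atN (rY None (mono (~~ i) i))) _ => w w0.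
  rewrite trY// /coefs_transition transitionE extE XP /= -/(f i).
  by case: i => /=; rewrite ?addn0; field.
have sc i : (size (c i) <= 2)%N.
  apply: size_growth_eq (rY (Some i) (mono false false)) _ => w w0.
  rewrite trY// /coefs_transition transitionE !extE mulE (hX _ None)// XP -/(c i) /=.
  by rewrite addn0 expr0 invr1 mul0r mulr0 subr0 mul1r expr1.
have fE i w : w != 0 -> w * (f i).[w^-1] = (f i)`_0 * w + (f i)`_1.
  by move=> w0; rewrite (horner_size2 _ (sf i)); field.
pose sgn (i : bool) : F := (-1) ^+ i.
have dE i z : (d i).[z] = - (sgn i * (f (~~ i))`_1).
  pose Q := d i + (sgn i * (f (~~ i))`_1)%:P.
  pose h w := w * Y w (Some i) (mono true true) - sgn i * (f (~~ i))`_0 * w.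
  have rh : regular_at h 0.
    apply: regular_atD; first by apply: regular_atM => //; exact: regular_at_id.
    by apply: regular_atN; regular.
  have hE w : w != 0 -> h w = Q.[w^-1].
    move=> w0; rewrite /h trY// /coefs_transition transitionE.
    have -> : sgn i * (f (~~ i))`_0 * w =
        sgn i * (w * (f (~~ i)).[w^-1] - (f (~~ i))`_1) by rewrite fE// addrK; ring.
    rewrite hornerD hornerC /sgn.
    by case: i {Q h rh}; rewrite !extE mulE !mk_extE !XP /= /f /d ?expr0 ?expr1; field.
  have sQ : (size Q <= 1)%N.
    by apply: size_growth_eq rh _ => w w0; rewrite hE// expr0 mul1r.
  have : h 0 = Q`_0.
    apply: (@regular_at_eq F h (fun=> Q`_0) 0 rh (regular_at_cst _ _)).
    have n0 := cofin_neq (0 : F); near=> w.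
    by rewrite hE ?horner_size1//; near: w.
  rewrite /h !(mul0r, mulr0, subr0) => /esym Q0.
  have := horner_size1 z sQ; rewrite Q0 hornerD hornerC => /eqP.
  by rewrite addr_eq0 => /eqP.
have [a [[a0 a1 a2 a3] [a4 a5 a6 a7]]] := params_exist (f false)`_0 (f false)`_1
  (f true)`_0 (f true)`_1 (c false)`_0 (c false)`_1 (c true)`_0 (c true)`_1.
exists a; apply/funext => z; apply/funext => -[[]|]; apply: ext2P => -[] [];
  rewrite mk_extE /=; try (by apply: hX);
  rewrite XP ?(a0, a1, a2, a3, a4, a5, a6, a7).
- by rewrite dE /sgn expr1 mulN1r opprK.
- exact: horner_size2 (sc true).
- by rewrite dE /sgn expr0 mul1r.
- exact: horner_size2 (sc false).
- exact: horner_size2 (sf false).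
- exact: horner_size2 (sf true).
Unshelve. all: by end_near.
Qed.

End GlobalFields.

Lemma tangent_cohomology (F : closedFieldType) :
  h0_is (tangent F 2) 8 8 /\ h1_is (tangent F 2) 0 0.
Proof.
split; split.
- apply: (H0_dim_parametrized (@even_vfield F)).
  + by move=> c a b; have [] := even_linear c a b.
  + by move=> c a b; have [] := even_linear c a b.
  + exact: even_inj.
  + exact: even_surj.
- apply: (H0_dim_parametrized (@odd_vfield F)).
  + by move=> c a b; have [] := odd_linear c a b.
  + by move=> c a b; have [] := odd_linear c a b.
  + exact: odd_inj.
  + exact: odd_surj.
- exact/mittag_leffler_H1/mittag_leffler.
- exact/mittag_leffler_H1/mittag_leffler.
Qed.

Theorem mainTheorem10 (R : realType) :
  h0_is (tangent R[i] 2) 8 8 /\ h1_is (tangent R[i] 2) 0 0.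
Proof. exact: tangent_cohomology. Qed.
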